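(* Let $D\subset\mathbb{R}^d$ be a compact domain of positive measure $|D|$ and let $\mu$ be a Borel probability measure on $L^2(D)$ with $\int\|u\|_{L^2}^2\,d\mu(u)<\infty$, concentrated on continuous functions. Let $\lambda_1\ge\lambda_2\ge\dots$ be the eigenvalues (with multiplicity) of the uncentered covariance operator $\overline{\Gamma}=\int u\otimes u\,d\mu(u)$ and $\phi_1,\phi_2,\dots$ an associated orthonormal eigenbasis of $L^2(D)$ consisting of continuous functions. If $\sup_{\ell\in\mathbb{N}}\|\phi_\ell\|_{L^\infty}<\infty$, then there exists a constant $C\ge1$, depending only on $\sup_\ell\|\phi_\ell\|_{L^\infty}$ and $|D|$, such that for iid random sensors $X_1,X_2,X_3,\dots\sim\mathrm{Unif}(D)$, with probability $1$, the encoding error with the $M$ random sensors $X_1,\dots,X_M$ satisfies $$\widehat{\mathscr{E}}_{\mathcal{E}}(X_1,\dots,X_M)\le C\sqrt{\sum_{\ell>M/(C\log M)}\lambda_\ell}$$ for all but finitely many $M\in\mathbb{N}$.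
   Context: The random encoder is $\mathcal{E}(u)=(u(X_1),\dots,u(X_M))$. For $m\le M$ let $\Phi_M=[\phi_i(X_j)]_{i\le m,\,j\le M}\in\mathbb{R}^{m\times M}$; when $\Phi_M\Phi_M^T$ is invertible, the associated linear decoder is $\mathcal{D}:\mathbb{R}^M\to L^2(D)$, $\mathcal{D}(u_1,\dots,u_M)=\sum_{k=1}^m\sum_{j=1}^M[\Phi_M^\dagger]_{kj}\,u_j\,\phi_k$, with $\Phi_M^\dagger=(\Phi_M\Phi_M^T)^{-1}\Phi_M$. The encoding error is $\widehat{\mathscr{E}}_{\mathcal{E}}(X_1,\dots,X_M)=\left(\int\|\mathcal{D}\circ\mathcal{E}(u)-u\|_{L^2(D)}^2\,d\mu(u)\right)^{1/2}$; the statement asserts that for all but finitely many $M$ there is a choice $m=m(M)\le M$ for which $\Phi_M\Phi_M^T$ is invertible and the bound holds with this decoder. *)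

(* Defs.v *)
From HB Require Import structures.
From mathcomp Require Import all_boot all_order all_algebra.
From mathcomp Require Import all_classical all_reals all_analysis.
From mathcomp Require Import measurable_realfun.
Set Implicit Arguments.
Unset Strict Implicit.
Unset Printing Implicit Defensive.
Import Order.TTheory GRing.Theory Num.Theory.
Import numFieldNormedType.Exports.
Local Open Scope classical_set_scope.
Local Open Scope ring_scope.

Definition eucl (R : realType) (d : nat) : Type := 'rV[R]_d.

HB.instance Definition _ (R : realType) d := NormedModule.on (eucl R d).

Definition borel_display : measure_display. Proof. exact. Qed.

Section eucl_measurable.
Context (R : realType) (d : nat).
Let B := <<s @open (eucl R d) >>.
Let B0 : B set0. Proof. exact: sigma_algebra0. Qed.
Let BC (A : set (eucl R d)) : B A -> B (~` A).
Proof. by move=> BA; rewrite -setTD; exact: sigma_algebraCD. Qed.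
Let Bcup (F : (set (eucl R d))^nat) : (forall i, B (F i)) -> B (\bigcup_i F i).
Proof. exact: sigma_algebra_bigcup. Qed.
HB.instance Definition _ := @isMeasurable.Build borel_display (eucl R d)
  B B0 BC Bcup.
End eucl_measurable.

Section eucl_borel.
Context (R : realType).

Lemma eucl_open_measurable d (U : set (eucl R d)) : open U -> measurable U.
Proof. exact: sub_sigma_algebra. Qed.

Lemma eucl_compact_measurable d (D : set (eucl R d)) :
  compact D -> measurable D.
Proof.
move=> /compact_closed cD; rewrite -[D]setCK; apply: measurableC.
by apply: eucl_open_measurable; apply: closed_openC; apply: cD;
  exact: norm_hausdorff.
Qed.

Lemma measurable_eucl_coord d (i : 'I_d) :
  measurable_fun [set: eucl R d] (fun v : eucl R d => v ord0 i).
Proof.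
apply: (measurability _ (measurable_realfun.RGenOpens.measurableE R))
  => _ [_ [a [b ->] <-]].
rewrite setTI; apply: eucl_open_measurable.
apply: open_comp; last exact: interval_open.
by move=> v _; exact: coord_continuous.
Qed.

Let rball d (q : 'rV[rat]_d * rat) : set (eucl R d) :=
  [set v | forall i, `|ratr (q.1 ord0 i) - v ord0 i| < ratr q.2].

Let rball_cover d (U : set (eucl R d)) : open U ->
  U = \bigcup_(q in [set q | rball q `<=` U]) rball q.
Proof.
move=> oU; apply/seteqP; split=> [x Ux|x [q]]; last exact.
have : nbhs x U by exact: open_nbhs_nbhs.
rewrite -nbhs_ballE => -[e /= e0 xeU].
have /rat_in_itvoo[r] : 0 < e / 2 by rewrite divr_gt0.
rewrite in_itv/= => /andP[r0 re].
have /(_ _)/cid-/all_sig[q xq] (i : 'I_d) : exists q : rat,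
    `|ratr q - (x : 'rV[R]_d) ord0 i| < ratr r.
  have /rat_in_itvoo[q] : (x : 'rV[R]_d) ord0 i - ratr r < (x : 'rV[R]_d) ord0 i + ratr r.
    by rewrite ltrD2l gtrN.
  by rewrite in_itv/= => /andP[qx xq]; exists q; rewrite ltr_distl qx.
exists (\row_i q i, r) => /= [y /= yq|i /=]; last by rewrite mxE.
apply: xeU; split=> // i j; rewrite ord1 /ball/=.
have := yq j; rewrite mxE => {}yq.
rewrite [e]splitr (le_lt_trans (ler_distD (ratr (q j)) _ _))// ltrD//.
  by rewrite distrC (lt_trans (xq j)).
by rewrite (lt_trans yq).
Qed.

Lemma measurable_to_eucl d' (T : measurableType d') d (f : T -> eucl R d) :
  (forall i, measurable_fun setT (fun t => f t ord0 i)) ->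
  measurable_fun setT f.
Proof.
move=> mf; apply: (@measurability _ _ T (eucl R d) setT f open) => //.
move=> _ [U oU <-]; rewrite setTI (rball_cover oU) preimage_bigcup.
rewrite bigcup_mkcond; apply: countable_bigcupT_measurable => // q.
case: ifPn => // _.
rewrite (_ : f @^-1` _ = \bigcap_(i in [set: 'I_d])
    ((fun t => f t ord0 i) @^-1`
      `](ratr (q.1 ord0 i) - ratr q.2), (ratr (q.1 ord0 i) + ratr q.2)[)).
  apply: fin_bigcap_measurable => // i _.
  rewrite -[X in measurable X]setTI.
  by apply: mf => //; exact: measurable_itv.
apply/seteqP; split=> [t ft i _|t ft i] /=.
  by rewrite in_itv/= -ltr_distlC; exact: ft.
by have := ft i I; rewrite /= in_itv/= -ltr_distlC.
Qed.

End eucl_borel.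

(* Lebesgue measure on R^(d+1) from the product of Lebesgue measure on R and on
    R^d, transported along (x, v) |-> row_mx x v. *)
Section lebesgue_step.
Context (R : realType) (d : nat).
Local Open Scope ereal_scope.

Let cons (p : measurableTypeR R * eucl R d) : eucl R d.+1 :=
  row_mx (p.1%:M : 'M[R]_1) p.2 : 'rV[R]_(1 + d).

Let uncons (v : eucl R d.+1) : measurableTypeR R * eucl R d :=
  ((v : 'rV[R]_d.+1) ord0 ord0, rsubmx (v : 'rV[R]_(1 + d))).

Let mcons : measurable_fun setT cons.
Proof.
apply: measurable_to_eucl => i.
have [j ->|j ->] := split_ordP (i : 'I_(1 + d)).
  rewrite (_ : (fun _ => _) = fst); first exact: measurable_fst.
  by apply/funext => p; apply: etrans (row_mxEl _ _ _ _) _;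
    rewrite mxE; case: j => -[].
rewrite (_ : (fun _ => _) = (fun v : eucl R d => (v : 'rV[R]_d) ord0 j) \o snd).
  exact: measurableT_comp (measurable_eucl_coord j) measurable_snd.
by apply/funext => p; exact: row_mxEr.
Qed.

Let muncons : measurable_fun setT uncons.
Proof.
apply: measurable_fun_pair => /=.
  exact: (@measurable_eucl_coord R d.+1 ord0).
apply: measurable_to_eucl => i.
rewrite (_ : (fun _ => _) = (fun v : eucl R d.+1 => (v : 'rV[R]_d.+1) ord0 (rshift 1 i))).
  exact: (@measurable_eucl_coord R d.+1).
by apply/funext => v; rewrite mxE.
Qed.

Let consK : cancel cons uncons.
Proof.
move=> [x v]; rewrite /cons /uncons/=; congr pair; last exact: row_mxKr.
rewrite (_ : ord0 = lshift d (ord0 : 'I_1)); last exact/val_inj.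
by apply: etrans (row_mxEl _ _ _ _) _; rewrite mxE.
Qed.

Definition lebesgue_step (m : {sigma_finite_measure set (eucl R d) -> \bar R})
  := pushforward (@lebesgue_measure R \x m) cons.

Variable m : {sigma_finite_measure set (eucl R d) -> \bar R}.

Let step0 : lebesgue_step m set0 = 0.
Proof. by rewrite /lebesgue_step /pushforward preimage_set0 measure0. Qed.

Let step_ge0 A : 0 <= lebesgue_step m A.
Proof. exact: measure_ge0. Qed.

Let mpre A : measurable A -> measurable (cons @^-1` A).
Proof. by move=> mA; rewrite -[X in measurable X]setTI; exact: mcons. Qed.

Let step_sigma_additive : semi_sigma_additive (lebesgue_step m).
Proof.
move=> F mF tF mUF; rewrite /lebesgue_step /pushforward preimage_bigcup.
apply: measure_semi_sigma_additive.
- by move=> n; exact: mpre.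
- apply/trivIsetP => /= i j _ _ ij; rewrite -preimage_setI.
  by move/trivIsetP : tF => /(_ _ _ _ _ ij) ->//; rewrite preimage_set0.
- by rewrite -preimage_bigcup; exact: mpre.
Qed.

HB.instance Definition _ := isMeasure.Build _ _ _ (lebesgue_step m)
  step0 step_ge0 step_sigma_additive.

Let step_sigma_finite : sigma_finite setT (lebesgue_step m).
Proof.
have /sigma_finiteP[F [TF ndF Foo]] := sigma_finiteT (@lebesgue_measure R).
have /sigma_finiteP[G [TG ndG Goo]] := sigma_finiteT m.
exists (fun n => uncons @^-1` (F n `*` G n)).
  apply/seteqP; split=> // v _.
  have [i _ Fi] : (\bigcup_i F i) (uncons v).1 by rewrite -TF.
  have [j _ Gj] : (\bigcup_i G i) (uncons v).2 by rewrite -TG.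
  exists (maxn i j) => //; split.
    by move: Fi; exact/subsetPset/ndF/leq_maxl.
  by move: Gj; exact/subsetPset/ndG/leq_maxr.
move=> n; have [mF Fn] := Foo n; have [mG Gn] := Goo n; split.
  by rewrite -[X in measurable X]setTI; apply: muncons => //;
    exact: measurableX.
rewrite /lebesgue_step /pushforward (_ : _ @^-1` _ = F n `*` G n).
  by rewrite product_measure1E// lte_mul_pinfty// ge0_fin_numE.
by rewrite -comp_preimage (_ : uncons \o cons = id) ?preimage_id//;
  exact/funext/consK.
Qed.

HB.instance Definition _ := Measure_isSigmaFinite.Build _ _ _ (lebesgue_step m)
  step_sigma_finite.

End lebesgue_step.

Fixpoint lebesgue_eucl (R : realType) (d : nat) :
    {sigma_finite_measure set (eucl R d) -> \bar R} :=
  if d is d'.+1 then lebesgue_step (lebesgue_eucl R d')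
  else \d_(0 : eucl R 0).

Lemma lebesgue_euclX (R : realType) d (A : 'I_d -> set (measurableTypeR R)) :
  (forall i, measurable (A i)) ->
  (lebesgue_eucl R d [set v | forall i, A i ((v : 'rV[R]_d) ord0 i)] =
   \prod_(i < d) lebesgue_measure (A i))%E.
Proof.
elim: d A => [|d IHd] A mA.
  by rewrite big_ord0 /= diracE mem_set// => -[].
have mbox : measurable [set v : eucl R d |
    forall i, A (lift ord0 i) ((v : 'rV[R]_d) ord0 i)].
  rewrite (_ : [set _ | _] = \bigcap_(i in [set: 'I_d])
    ((fun v : eucl R d => (v : 'rV[R]_d) ord0 i) @^-1` A (lift ord0 i))).
    apply: fin_bigcap_measurable => // i _.
    by have := measurable_eucl_coord i measurableT (mA (lift ord0 i));
      rewrite setTI.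
  by apply/seteqP; split=> v /= Av i; [move=> _; exact: Av|exact: Av].
rewrite big_ord_recl -IHd//= -product_measure1E// /lebesgue_step /pushforward.
congr product_measure1; apply/seteqP; split=> -[x v] /=.
  move=> xv; split=> [|i].
    have := xv ord0; rewrite (_ : ord0 = lshift d (ord0 : 'I_1)).
      by rewrite (row_mxEl (x%:M : 'M[R]_1) v) mxE.
    exact/val_inj.
  have := xv (lift ord0 i).
  rewrite (_ : lift ord0 i = rshift 1 i).
    by rewrite (row_mxEr (x%:M : 'M[R]_1) v).
  exact/val_inj.
move=> [Ax Av] i; have [j ->|j ->] := split_ordP (i : 'I_(1 + d)).
  rewrite (row_mxEl (x%:M : 'M[R]_1) v) mxE ord1 eqxx mulr1n.
  by rewrite (_ : (lshift d (ord0 : 'I_1) : 'I_d.+1) = ord0)//; exact/val_inj.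
rewrite (row_mxEr (x%:M : 'M[R]_1) v).
by rewrite (_ : (rshift 1 j : 'I_d.+1) = lift ord0 j)//; exact/val_inj.
Qed.

Definition L2 d (T : measurableType d) (R : realType)
  (mu : {measure set T -> \bar R}) : Type := LspaceType2 mu.

Section L2_structure.
Context d (T : measurableType d) (R : realType) (mu : {measure set T -> \bar R}).

Definition L2fun (u : L2 mu) : T -> R := (u : LspaceType2 mu).
Coercion L2fun : L2 >-> Funclass.

Definition L2norm (f : T -> R) : \bar R := 'N[mu]_2%:E [EFin \o f].

Definition L2dot (f g : T -> R) : R := \int[mu]_x (f x * g x).

Lemma ae_eq_L2norm (f g : T -> R) :
  measurable_fun setT f -> measurable_fun setT g -> f = g %[ae mu] ->
  L2norm f = L2norm g.
Proof.
have mN (h : T -> R) : measurable_fun setT h ->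
    measurable_fun setT (fun x => `|(EFin \o h) x| `^ 2)%E.
  move=> mh; apply: (@measurableT_comp _ _ _ _ _ _ (fun y => poweR y 2)).
    exact: measurable_poweR.
  by apply: measurableT_comp => //; exact/measurable_EFinP.
move=> mf mg fg; rewrite /L2norm unlock; congr poweR.
apply: ae_eq_integral => //; [exact: mN|exact: mN|].
by apply: filterS fg => x /= /[apply] ->.
Qed.

Lemma measurable_L2fun (u : L2 mu) : measurable_fun setT u.
Proof.
exact: (measurable_funPT (repr ((u : LspaceType2 mu) :
  {mfun_ mu, T >-> measurableTypeR R}))).
Qed.

Lemma L2norm_lty (u : L2 mu) : (L2norm u < +oo)%E.
Proof. exact: (@Lebesgue_finite _ _ _ _ _ (lee1n 2) (u : LspaceType2 mu)). Qed.

Lemma L2_eqP (u v : L2 mu) : L2fun u = L2fun v %[ae mu] -> u = v.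
Proof.
move: u v => [u [[cu]]] [v [[cv]]] uv.
have uvE : u = v.
  have /eqP : (u == v %[mod {mfun_ mu, T >-> measurableTypeR R}])%qT.
    exact/ae_eqP.
  by rewrite !reprK.
by subst v; rewrite (Prop_irrelevance cu cv).
Qed.

Section L2_of.
Variables (f : T -> R) (mf : measurable_fun setT f).
Variable ff : (L2norm f < +oo)%E.

Let f' : {mfun T >-> measurableTypeR R} :=
  @mfun_Sub _ _ T (measurableTypeR R) f
    (mem_set (mf : @measurable_fun _ _ T (measurableTypeR R) setT f)).

Let cls : {mfun_ mu, T >-> measurableTypeR R} := \pi_(_)%qT f'.

Let clsE : (cls : T -> R) = f %[ae mu].
Proof.
have : (repr cls = f' %[mod {mfun_ mu, T >-> measurableTypeR R}])%qT.
  by rewrite reprK.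
by move/eqmodP => /asboolP.
Qed.

Let cls_finite : finite_norm mu 2%:E cls.
Proof.
rewrite /finite_norm -/(L2norm (cls : T -> R)) (ae_eq_L2norm _ mf clsE)//.
exact: (measurable_funPT (repr cls)).
Qed.

HB.instance Definition _ := isFinLebesgue.Build _ _ _ mu 2%:E (lee1n 2)
  cls cls_finite.

Definition L2_of : L2 mu := (cls : LspaceType2 mu).

Lemma L2_ofE : L2fun L2_of = f %[ae mu].
Proof. exact: clsE. Qed.

End L2_of.

Definition L2dist (u v : L2 mu) : R := fine (L2norm (u \- v)%R).

Let mB (u v : L2 mu) : measurable_fun setT (u \- v).
Proof. by apply: measurable_funB; exact: measurable_L2fun. Qed.

Let L2normN (f : T -> R) : L2norm (fun x => - f x) = L2norm f.
Proof. exact: (oppe_Lnorm mu (EFin \o f) 2%:E). Qed.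

Let L2normBC (u v : L2 mu) : L2norm (v \- u)%R = L2norm (u \- v)%R.
Proof.
by rewrite -L2normN; congr L2norm; apply/funext => x /=; rewrite opprB.
Qed.

Let L2normB_triangle (v u w : L2 mu) :
  (L2norm (u \- w)%R <= L2norm (u \- v)%R + L2norm (v \- w)%R)%E.
Proof.
rewrite (_ : u \- w = (u \- v) \+ (v \- w))%R; last first.
  by apply/funext => x /=; rewrite addrA subrK.
by apply: eminkowski; rewrite ?lee1n//; exact: mB.
Qed.

Let L2normB_lty (u v : L2 mu) : (L2norm (u \- v)%R < +oo)%E.
Proof.
rewrite (@le_lt_trans _ _ (L2norm u + L2norm v)%E) ?lte_add_pinfty ?L2norm_lty//.
rewrite -(L2normN v); apply: (@eminkowski _ _ _ _ u (fun x => - v x) 2%:E).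
- exact: measurable_L2fun.
- by apply: measurableT_comp => //; exact: measurable_L2fun.
- by rewrite lee1n.
Qed.

Lemma L2dist_fineK (u v : L2 mu) : (L2dist u v)%:E = L2norm (u \- v)%R.
Proof. by rewrite fineK// ge0_fin_numE ?L2normB_lty// Lnorm_ge0. Qed.

Let L2distxx (u : L2 mu) : L2dist u u = 0.
Proof.
rewrite /L2dist (_ : u \- u = cst 0) ?/L2norm; last first.
  by apply/funext => x /=; rewrite subrr.
by rewrite (_ : _ \o _ = cst 0%E)// Lnorm0.
Qed.

Let L2dist_positivity (u v : L2 mu) : L2dist u v = 0 -> u = v.
Proof.
move=> uv0; apply: L2_eqP.
have := L2dist_fineK u v; rewrite uv0 => /esym/Lnorm_eq0_eq0.
have /measurable_EFinP muv := mB u v.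
move=> /(_ muv (ltac:(by rewrite lte_fin))).
by apply: filterS => x /(_ I)/= [] /eqP; rewrite subr_eq0 => /eqP.
Qed.

Let L2dist_sym (u v : L2 mu) : L2dist u v = L2dist v u.
Proof. by rewrite /L2dist L2normBC. Qed.

Let L2dist_triangle (v u w : L2 mu) : L2dist u w <= L2dist u v + L2dist v w.
Proof. by rewrite -lee_fin EFinD !L2dist_fineK. Qed.

HB.instance Definition _ := gen_eqMixin (L2 mu).
HB.instance Definition _ := gen_choiceMixin (L2 mu).
HB.instance Definition _ := isMetric.Build R (L2 mu)
  L2distxx L2dist_positivity L2dist_sym L2dist_triangle.

Let mcst0 : measurable_fun [set: T] (cst (0 : R)).
Proof. exact: measurable_cst. Qed.

Let L2norm0 : (L2norm (cst 0%R) < +oo)%E.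
Proof. by rewrite /L2norm (_ : _ \o _ = cst 0%E)// Lnorm0. Qed.

HB.instance Definition _ :=
  isPointed.Build (L2 mu) (L2_of mcst0 L2norm0).

Let B := <<s @open (L2 mu) >>.
Let B0 : B set0. Proof. exact: sigma_algebra0. Qed.
Let BC (A : set (L2 mu)) : B A -> B (~` A).
Proof. by move=> BA; rewrite -setTD; exact: sigma_algebraCD. Qed.
Let Bcup (F : (set (L2 mu))^nat) : (forall i, B (F i)) -> B (\bigcup_i F i).
Proof. exact: sigma_algebra_bigcup. Qed.
HB.instance Definition _ := @isMeasurable.Build borel_display (L2 mu)
  B B0 BC Bcup.

End L2_structure.

Section random_points.
Local Open Scope ereal_scope.
Context dO (Om : measurableType dO) (R : realType) (P : probability Om R).

Definition mutually_independent dT (T : measurableType dT)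
    (X : nat -> {RV P >-> T}) :=
  forall (J : seq nat) (A : nat -> set T), uniq J ->
    (forall j, measurable (A j)) ->
    P (\bigcap_(j in [set` J]) X j @^-1` A j) =
    \prod_(j <- J) P (X j @^-1` A j).

Definition uniform_on d (D : set (eucl R d)) (X : {RV P >-> eucl R d}) :=
  forall A, measurable A ->
    distribution P X A = lebesgue_eucl R d (A `&` D) / lebesgue_eucl R d D.

End random_points.

Section encoding.
Context (R : realType) (d : nat) (D : set (eucl R d)) (cD : compact D).

Definition lebesgue_on : {measure set (eucl R d) -> \bar R} :=
  mrestr (lebesgue_eucl R d) (eucl_compact_measurable cD).

Local Notation L2D := (L2 lebesgue_on).

Definition continuous_version (u : L2D) : set (eucl R d -> R) :=
  [set f | {within D, continuous f} /\ f = L2fun u %[ae lebesgue_on]].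

(* Point evaluation of a class. Two continuous versions of u agree on the support
   of Lebesgue measure on D, i.e. off a null set that does not depend on u, so
   the choice is immaterial at almost every point of D. *)
Definition peval (u : L2D) : eucl R d -> R :=
  xget (cst 0) (continuous_version u).

Definition tensor (u v w : L2D) : eucl R d -> R :=
  fun x => L2dot lebesgue_on v w * u x.

(* y is the L^2(D)-valued integral of F in the weak (Pettis) sense; for the
   covariance of a law with finite second moment it agrees with the Bochner
   integral. *)
Definition weak_integral dO (Om : measurableType dO)
    (mu : {measure set Om -> \bar R})
    (F : Om -> eucl R d -> R) (y : L2D) :=
  forall w : L2D,
    mu.-integrable setT (fun o => (L2dot lebesgue_on (F o) w)%:E) /\
    L2dot lebesgue_on y w = \int[mu]_o L2dot lebesgue_on (F o) w.

Definition uncentered_covariance (mu : probability L2D R)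
    (Gamma : L2D -> L2D) :=
  forall v, weak_integral mu (fun u => tensor u u v) (Gamma v).

Definition orthonormal_basis (phi : nat -> L2D) :=
  (forall i j, L2dot lebesgue_on (phi i) (phi j) = (i == j)%:R) /\
  (forall u : L2D,
    (fun n => L2norm lebesgue_on (fun x =>
       u x - \sum_(i < n) L2dot lebesgue_on u (phi i) * phi i x))
    @ \oo --> 0%E).

(* 0-based: lam l and phi l are the (l+1)-st eigenvalue and eigenfunction. *)
Definition eigensystem (Gamma : L2D -> L2D)
    (lam : nat -> R) (phi : nat -> L2D) :=
  [/\ nonincreasing_seq lam,
      orthonormal_basis phi &
      forall l, L2fun (Gamma (phi l)) = (fun x => lam l * phi l x)
                %[ae lebesgue_on]].

Definition sup_Linfty (phi : nat -> L2D) : \bar R :=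
  ereal_sup (range (fun l => 'N[lebesgue_on]_+oo[EFin \o L2fun (phi l)]))%E.

Definition encoder M (x : 'I_M -> eucl R d) (u : L2D) : 'rV[R]_M :=
  \row_j peval u (x j).

Definition sampling_matrix (phi : nat -> L2D) (m M : nat)
    (x : 'I_M -> eucl R d) : 'M[R]_(m, M) :=
  \matrix_(k, j) peval (phi k) (x j).

Definition gram (phi : nat -> L2D) (m M : nat)
    (x : 'I_M -> eucl R d) : 'M[R]_m :=
  sampling_matrix phi m x *m (sampling_matrix phi m x)^T.

Definition pinv_sampling (phi : nat -> L2D) (m M : nat)
    (x : 'I_M -> eucl R d) : 'M[R]_(m, M) :=
  invmx (gram phi m x) *m sampling_matrix phi m x.

Definition decoder (phi : nat -> L2D) (m M : nat)
    (x : 'I_M -> eucl R d) (y : 'rV[R]_M) : eucl R d -> R :=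
  fun t => \sum_(k < m) \sum_(j < M)
    pinv_sampling phi m x k j * y ord0 j * phi k t.

Definition encoding_error (mu : probability L2D R)
    (phi : nat -> L2D) (m M : nat) (x : 'I_M -> eucl R d) : \bar R :=
  sqrte (\int[mu]_u (L2norm lebesgue_on
    (fun t => (decoder phi m x (encoder x u) t - u t)%R) ^+ 2))%E.

End encoding.

(* Main.v *)
(* Let P_m be the projection on the first m eigenfunctions. As the decoder reproduces
   the span of phi_1, ..., phi_m, the error on u is u - P_m u plus the decoding of the
   samples of u - P_m u, so it is controlled by the tail of the eigenvalues as soon as
   the least eigenvalue of Phi Phi^T is at least M / (8 |D|): the mean square of
   u - P_m u at a point is at most sup |phi|^2 times that tail.

   The eigenvalue bound is a lower matrix Chernoff inequality, proved without the
   matrix exponential. With y_j = sqrt |D| phi(X_j) and R_n = (K + sum_(j < n) y_j y_j^T)^-1,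
   the potential tr R_n^p satisfies, when p |y_j|^2 <= K / 4,
     E tr R_(n+1)^p <= E tr R_n^p - (p / 2) E tr R_n^(p+1)
   (Sherman-Morrison), hence E tr R_n^p <= m (K + n / 2)^-p. Taking K = M / 8 and p of
   order log M, Markov's inequality and Borel-Cantelli conclude. *)
Require Import Defs.
From HB Require Import structures.
From mathcomp Require Import all_boot all_order all_algebra.
From mathcomp Require Import all_classical all_reals all_analysis.
From mathcomp Require Import measurable_realfun ess_sup_inf.
From mathcomp Require Import ring lra zify.
Set Implicit Arguments.
Unset Strict Implicit.
Unset Printing Implicit Defensive.
Import Order.TTheory GRing.Theory Num.Theory.
Import numFieldNormedType.Exports.
Local Open Scope classical_set_scope.
Local Open Scope ring_scope.

(** * Positive semidefinite forms *)

(** Two obstacles shape the development. Point evaluation [peval] involves a choice, and u |->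
    [peval u x] is not known to be measurable; integrals over u are therefore bounded through
    measurable majorants, obtained as lower limits of pairings with averages over shrinking balls.
    On the matrix side no diagonalisation is used: what one would read off a spectrum comes from the
    moments a^T S^k a, which are log-convex by Cauchy-Schwarz, and from traces of powers. The power
    p is the source of the logarithm. It must be of order log M for the failure probability m
    (2/5)^p to be summable, while p |y|^2 <= K / 4 has to hold with |y|^2 bounded only by m |D| sup
    |phi|^2; this restricts m to the order of M / log M. The recursion for the expected potential
    averages over one sensor with the earlier ones fixed. Conditional expectations are replaced by
    Tonelli's theorem on the product of the past sigma-algebra with the law of the next sensor. *)

Section log_convex.
Variables (R : realFieldType) (u : nat -> R).
Hypothesis u_ge0 : forall k, 0 <= u k.
Hypothesis u_lc : forall k, u k.+1 ^+ 2 <= u k * u k.+2.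

(** The ratios of consecutive terms do not decrease. The form without division covers vanishing
    terms: log-convexity makes the successor of a zero term zero. *)
Lemma log_convex_ratio n k : u n.+1 * u (n + k)%N <= u n * u (n + k).+1.
Proof.
elim: k => [|k IH]; first by rewrite addn0 mulrC.
rewrite addnS; have [uk0|uk_neq0] := eqVneq (u (n + k)%N) 0.
  have : u (n + k).+1 ^+ 2 == 0.
    by rewrite eq_le sqr_ge0 andbT (le_trans (u_lc _))// uk0 mul0r.
  by rewrite sqrf_eq0 => /eqP ->; rewrite mulr0 mulr_ge0.
have uk_gt0 : 0 < u (n + k)%N by rewrite lt_neqAle eq_sym uk_neq0 u_ge0.
rewrite -(ler_pM2r uk_gt0) mulrAC.
apply: (le_trans (ler_wpM2r (u_ge0 _) IH)).
by rewrite -!mulrA; apply: ler_wpM2l => //; rewrite -expr2 mulrC.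
Qed.

(** Moving one unit of index from the smaller to the larger factor does not decrease the product. *)
Lemma log_convex_mul i j : u i * u j <= u 0%N * u (i + j)%N.
Proof.
wlog ij : i j / (i <= j)%N.
  by move=> H; case: (leqP i j) => [|/ltnW] /H//; rewrite mulrC addnC.
elim: i j ij => // i IH j ij.
have := log_convex_ratio i (j - i); rewrite subnKC ?(ltnW ij)// => /le_trans.
by apply; rewrite addSnnS IH// ltnW// ltnS ltnW.
Qed.

(** For the moments of a measure this is Jensen's inequality for the power k + 1. *)
Lemma log_convex_expr k : u 1%N ^+ k.+1 <= u 0%N ^+ k * u k.+1.
Proof.
elim: k => [|k IH]; first by rewrite expr1 expr0 mul1r.
rewrite exprS (le_trans (ler_wpM2l (u_ge0 _) IH))// mulrCA exprSr -mulrA.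
by apply: ler_wpM2l; rewrite ?exprn_ge0// log_convex_mul.
Qed.

End log_convex.

Section forms.
Variables (R : realFieldType) (m : nat).
Implicit Types (S T A : 'M[R]_m) (a b y : 'cV[R]_m).

Definition mxform S a b : R := (a^T *m S *m b) 0 0.

Lemma mxformE S a b : mxform S a b = \sum_i \sum_j a i 0 * S i j * b j 0.
Proof.
rewrite /mxform mxE exchange_big; apply: eq_bigr => j _ /=.
by rewrite mxE mulr_suml; apply: eq_bigr => i _; rewrite mxE.
Qed.

Lemma mxformDm S T a b : mxform (S + T) a b = mxform S a b + mxform T a b.
Proof. by rewrite /mxform mulmxDr mulmxDl mxE. Qed.

Lemma mxformBm S T a b : mxform (S - T) a b = mxform S a b - mxform T a b.
Proof. by rewrite /mxform mulmxBr mulmxBl !mxE. Qed.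

Lemma mxformZm (c : R) S a b : mxform (c *: S) a b = c * mxform S a b.
Proof. by rewrite /mxform -scalemxAr -scalemxAl mxE. Qed.

Lemma mxformDl S a a' b : mxform S (a + a') b = mxform S a b + mxform S a' b.
Proof. by rewrite /mxform linearD/= !mulmxDl mxE. Qed.

Lemma mxformZl (c : R) S a b : mxform S (c *: a) b = c * mxform S a b.
Proof. by rewrite /mxform linearZ/= -!scalemxAl mxE. Qed.

Lemma mxformDr S a b b' : mxform S a (b + b') = mxform S a b + mxform S a b'.
Proof. by rewrite /mxform !mulmxDr mxE. Qed.

Lemma mxformZr (c : R) S a b : mxform S a (c *: b) = c * mxform S a b.
Proof. by rewrite /mxform -!scalemxAr mxE. Qed.

Lemma mxformMr S T a b : mxform S a (T *m b) = mxform (S *m T) a b.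
Proof. by rewrite /mxform !mulmxA. Qed.

Lemma mxformMl S T a b : mxform S (T *m a) b = mxform (T^T *m S) a b.
Proof. by rewrite /mxform trmx_mul !mulmxA. Qed.

Lemma mxform_tr S a b : mxform S^T a b = mxform S b a.
Proof.
rewrite /mxform -[in LHS](trmxK (a^T *m S^T *m b)) [LHS]mxE.
by congr (_ _ _); rewrite !trmx_mul !trmxK mulmxA.
Qed.

Lemma mxformC S a b : S^T = S -> mxform S a b = mxform S b a.
Proof. by move=> sS; rewrite -mxform_tr sS. Qed.

Lemma mxform_rank1 a b y z : mxform (y *m z^T) a b = mxform 1%:M a y * mxform 1%:M z b.
Proof. by rewrite /mxform !mulmx1 mulmxA -mulmxA mxE big_ord1. Qed.

Lemma mxform1E a : mxform 1%:M a a = \sum_i a i 0 ^+ 2.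
Proof. by rewrite /mxform mulmx1 mxE; apply: eq_bigr => i _; rewrite mxE. Qed.

Lemma mxform1_ge0 a : 0 <= mxform 1%:M a a.
Proof. by rewrite mxform1E sumr_ge0// => i _; exact: sqr_ge0. Qed.

Definition psdmx S := S^T = S /\ forall a, 0 <= mxform S a a.

Lemma psdmx_CS S a b : psdmx S ->
  mxform S a b ^+ 2 <= mxform S a a * mxform S b b.
Proof.
move=> [sS S0].
have key (t : R) : 0 <= mxform S a a + 2 * t * mxform S a b + t ^+ 2 * mxform S b b.
  have := S0 (a + t *: b); rewrite mxformDl !mxformDr !mxformZl !mxformZr.
  by rewrite (mxformC b a sS); congr (_ <= _); ring.
have [b0|b_neq0] := eqVneq (mxform S b b) 0.
  have [->|ab0] := eqVneq (mxform S a b) 0; first by rewrite expr0n b0 mulr0.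
  (* The quadratic in t is affine here; this t would give it the value -1. *)
  have := key (- (mxform S a a + 1) / (2 * mxform S a b)).
  rewrite b0 mulr0 addr0.
  have -> : 2 * (- (mxform S a a + 1) / (2 * mxform S a b)) * mxform S a b =
      - (mxform S a a + 1) by field.
  by rewrite opprD addrA subrr sub0r ler0N1.
have bp : 0 < mxform S b b by rewrite lt_neqAle eq_sym b_neq0 S0.
have := key (- mxform S a b / mxform S b b).
have -> : mxform S a a + 2 * (- mxform S a b / mxform S b b) * mxform S a b +
   (- mxform S a b / mxform S b b) ^+ 2 * mxform S b b =
   (mxform S a a * mxform S b b - mxform S a b ^+ 2) / mxform S b b by field.
by rewrite pmulr_lge0 ?invr_gt0// subr_ge0.
Qed.

Lemma psdmx1 : psdmx 1%:M.
Proof. by split; [rewrite trmx1|move=> a; exact: mxform1_ge0]. Qed.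

Lemma psdmx_conj S T : psdmx S -> psdmx (T^T *m S *m T).
Proof.
move=> [sS S0]; split; first by rewrite !trmx_mul trmxK sS mulmxA.
by move=> a; rewrite -mxformMr -mxformMl.
Qed.

(** Induction by steps of two: S^(k+2) = S S^k S is a congruence of S^k. *)
Lemma psdmxX S k : psdmx S -> psdmx (S ^+ k).
Proof.
move=> pS; elim/ltn_ind: k => -[|[|k]] IH //.
- by rewrite expr0; exact: psdmx1.
- have := psdmx_conj S (IH k (leqW (leqnn _))).
  by rewrite pS.1 exprSr exprS.
Qed.

Lemma psdmx_scale (c : R) S : 0 <= c -> psdmx S -> psdmx (c *: S).
Proof.
move=> c0 [sS S0]; split; first by rewrite linearZ/= sS.
by move=> a; rewrite mxformZm mulr_ge0.
Qed.

Lemma mxform_delta S i j : mxform S (delta_mx i 0) (delta_mx j 0) = S i j.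
Proof. by rewrite /mxform trmx_delta -rowE -colE !mxE. Qed.

Lemma mxtrace_psd_ge0 S : psdmx S -> 0 <= \tr S.
Proof. by move=> [_ S0]; apply: sumr_ge0 => i _; rewrite -mxform_delta. Qed.

(** A Lagrange identity: the values of the form at the vectors a_i e_j - a_j e_i, summed over i and
    j, give twice the difference of the two sides. *)
Lemma mxform_le_trace S a : psdmx S -> mxform S a a <= \tr S * mxform 1%:M a a.
Proof.
move=> pS; rewrite -subr_ge0.
have : 0 <= \sum_i \sum_j mxform S (a i 0 *: delta_mx j 0 - a j 0 *: delta_mx i 0)
                    (a i 0 *: delta_mx j 0 - a j 0 *: delta_mx i 0).
  by do 2!(apply: sumr_ge0 => ? _); exact: pS.2.
under eq_bigr do under eq_bigr do
  rewrite -!scaleNr mxformDl !mxformDr !mxformZl !mxformZr !mxform_delta.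
set X := (X in 0 <= X -> _); have -> : X = 2 * (\tr S * mxform 1%:M a a - mxform S a a).
  have eX : X = \sum_i \sum_j (a i 0 ^+ 2 * S j j) - \sum_i \sum_j (a i 0 * S i j * a j 0)
    - \sum_i \sum_j (a i 0 * S j i * a j 0) + \sum_i \sum_j (a j 0 ^+ 2 * S i i).
    rewrite /X -!sumrB -big_split; apply: eq_bigr => i _ /=.
    by rewrite -!sumrB -big_split; apply: eq_bigr => j _ /=; ring.
  have e1 : \sum_i \sum_j (a i 0 ^+ 2 * S j j) = \tr S * mxform 1%:M a a.
    rewrite mxform1E mulrC mulr_suml; apply: eq_bigr => i _.
    by rewrite /mxtrace mulr_sumr.
  have e2 : \sum_i \sum_j (a j 0 ^+ 2 * S i i) = \tr S * mxform 1%:M a a.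
    by rewrite exchange_big.
  have e3 : \sum_i \sum_j (a i 0 * S j i * a j 0) = mxform S a a.
    rewrite mxformE; apply: eq_bigr => i _; apply: eq_bigr => j _.
    by rewrite -[in LHS]pS.1 mxE.
  by rewrite eX e1 e2 e3 -mxformE; ring.
by rewrite pmulr_rge0.
Qed.

(** The k-th moment of the spectral measure of S at a. *)
Definition moment S a k := mxform (S ^+ k) a a.

Lemma moment_ge0 S a k : psdmx S -> 0 <= moment S a k.
Proof. by move=> pS; exact: (psdmxX k pS).2. Qed.

(** Cauchy-Schwarz for the form S^k, applied to a and S a. *)
Lemma moment_log_convex S a k : psdmx S ->
  moment S a k.+1 ^+ 2 <= moment S a k * moment S a k.+2.
Proof.
move=> pS; have := psdmx_CS a (S *m a) (psdmxX k pS).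
rewrite mxformMl !mxformMr pS.1 /moment.
have -> : S ^+ k *m S = S ^+ k.+1 by rewrite exprSr.
have -> : S *m S ^+ k *m S = S ^+ k.+2 by rewrite exprS exprSr mulrA.
by [].
Qed.

End forms.

(** * Rank-one updates of an inverse *)

Section rank1_update.
Variables (R : realFieldType) (m : nat).
Implicit Types (S A : 'M[R]_m) (a y : 'cV[R]_m).

Lemma mxtrace_mul_rank1 S A a :
  \tr (S *m (a *m (a^T *m A))) = mxform (A *m S) a a.
Proof. by rewrite mulmxA mxtrace_mulC trace_mx11 /mxform !mulmxA. Qed.

(** The Sherman-Morrison expression for the inverse of S^-1 + y y^T, in which S is not inverted. *)
Definition rank1_update S y : 'M[R]_m :=
  S - (1 + mxform S y y)^-1 *: (S *m y *m (S *m y)^T).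

Lemma mxform_rank1_update S y a : S^T = S ->
  mxform (rank1_update S y) a a =
  mxform S a a - (1 + mxform S y y)^-1 * mxform S a y ^+ 2.
Proof.
move=> sS; rewrite /rank1_update mxformBm mxformZm mxform_rank1 mxformMr.
by rewrite mxformMl mul1mx mulmx1 sS (mxformC y a sS) expr2.
Qed.

Lemma psdmx_rank1_update S y : psdmx S -> psdmx (rank1_update S y).
Proof.
move=> pS; have [sS S0] := pS; split.
  by rewrite /rank1_update linearB/= linearZ/= trmx_mul trmxK sS.
move=> a; rewrite mxform_rank1_update// subr_ge0 mulrC ler_pdivrMr; last first.
  by rewrite ltr_wpDr.
rewrite (le_trans (psdmx_CS a y pS))// ler_wpM2l//.
by rewrite lerDr.
Qed.

Lemma rank1_update_le S y a : psdmx S ->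
  mxform (rank1_update S y) a a <= mxform S a a.
Proof.
move=> [sS S0]; rewrite mxform_rank1_update// gerBl mulr_ge0 ?sqr_ge0//.
by rewrite invr_ge0 addr_ge0.
Qed.

Lemma sherman_morrison A S y : psdmx S -> A *m S = 1%:M ->
  (A + y *m y^T) *m rank1_update S y = 1%:M.
Proof.
move=> [sS S0] AS; rewrite /rank1_update mulmxBr -scalemxAr !mulmxDl AS.
rewrite trmx_mul sS.
have -> : A *m (S *m y *m (y^T *m S)) = y *m (y^T *m S).
  by rewrite !mulmxA AS mul1mx.
have -> : y *m y^T *m (S *m y *m (y^T *m S)) = mxform S y y *: (y *m (y^T *m S)).
  rewrite -(mulmxA y) (mulmxA y^T) (mulmxA y^T) [y^T *m S *m y]mx11_scalar.
  by rewrite -/(mxform S y y) mul_scalar_mx -scalemxAr.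
rewrite -[X in X + _ *: _]scale1r -scalerDl scalerA mulVf.
  by rewrite scale1r -mulmxA addrK.
by rewrite gt_eqF// ltr_wpDr.
Qed.

(* Unfolding S' = S - c w w^T one factor at a time gives
   q (i + 1) j = q i (j + 1) - q i 0 * r j, and log-convexity of the moments of S
   gives r i * r j <= e * r (i + j + 1); hence q i j stays close to r (i + j). *)
Section trace_decrease.
Variables (S : 'M[R]_m) (y : 'cV[R]_m) (e : R).
Hypotheses (pS : psdmx S) (ye : mxform S y y <= e).
Let S' := rank1_update S y.
Let c := (1 + mxform S y y)^-1.
Let w := S *m y.
Let r k := c * mxform (S ^+ k) w w.
Let q i j := c * mxform (S' ^+ i *m S ^+ j) w w.

Let c_ge0 : 0 <= c. Proof. by rewrite invr_ge0 addr_ge0// pS.2. Qed.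

Let pS' : psdmx S'. Proof. exact: psdmx_rank1_update. Qed.

Let r_ge0 k : 0 <= r k.
Proof. by rewrite mulr_ge0// (psdmxX k pS).2. Qed.

Let rE k : r k = c * moment S y k.+2.
Proof.
by rewrite /r /w mxformMr mxformMl pS.1 /moment exprS exprSr.
Qed.

Let qS i j : q i.+1 j = q i j.+1 - q i 0 * r j.
Proof.
rewrite /q /r exprSr -mulmxE -mulmxA.
have -> : S' *m S ^+ j = S ^+ j.+1 - c *: (w *m (w^T *m S ^+ j)).
  by rewrite /S' /rank1_update -/w mulmxBl -scalemxAl -mulmxA exprS.
rewrite mulmxBr mxformBm mulrBr expr0 mulmx1 -scalemxAr mxformZm; congr (_ - _).
rewrite mulmxA /mxform -!mulrA; congr (_ * _); rewrite mulrCA; congr (_ * _).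
rewrite !mulmxA.
set X := w^T *m S' ^+ i *m S *m y.
have -> : X *m w^T *m S ^+ j *m S *m y = X *m (w^T *m S ^+ j *m S *m y).
  by rewrite !mulmxA.
by rewrite [LHS]mxE big_ord1.
Qed.

Let q_le i j : q i j <= r (i + j).
Proof.
elim: i j => [j|i IH j]; first by rewrite /q expr0 mul1mx.
rewrite qS addSnnS (le_trans _ (IH _))// gerBl mulr_ge0//.
by rewrite /q expr0 mulmx1 mulr_ge0// (psdmxX i pS').2.
Qed.

Let r_mul i j : r i * r j <= e * r (i + j).+1.
Proof.
(* The sequence starts at the first moment, so that its zeroth term is [mxform S y y], which is at
   most e. *)
have := @log_convex_mul R (fun k => moment S y k.+1)
  (fun k => moment_ge0 y _ pS) (fun k => moment_log_convex y _ pS) i.+1 j.+1.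
rewrite !rE addSn addnS.
have -> : moment S y 1 = mxform S y y by rewrite /moment expr1.
set t := mxform S y y; move=> h.
have t0 : 0 <= t by exact: pS.2.
have h1 : c * t <= e.
  by rewrite (le_trans _ ye)// ler_piMl// /c invf_le1 ?lerDl// ltr_wpDr.
rewrite mulrACA (le_trans (ler_wpM2l (mulr_ge0 c_ge0 c_ge0) h))//.
by rewrite mulrACA ler_wpM2r// mulr_ge0// moment_ge0.
Qed.

Let q_ge i j : r (i + j) * (1 - i%:R * e) <= q i j.
Proof.
elim: i j => [j|i IH j]; first by rewrite /q expr0 mul1mx mul0r subr0 mulr1.
rewrite qS addSnnS.
have h : q i 0 * r j <= e * r (i + j).+1.
  by rewrite (le_trans _ (r_mul _ _))// ler_wpM2r// (le_trans (q_le _ _))// addn0.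
rewrite (le_trans _ (lerB (IH j.+1) h))// addnS -natr1.
by rewrite le_eqVlt; apply/orP; left; apply/eqP; ring.
Qed.

(** The mixed products S'^k S^(p-k) lead from S^p to S'^p. Each step lowers the trace by exactly
    [q k (p - k.+1)], hence by at least (1 - p e) [r p.-1], and c >= 1 / (1 + e) turns r into a
    moment of S. *)
Lemma mxtrace_rank1_update p : p%:R * e <= 1 ->
  \tr (rank1_update S y ^+ p) +
    p%:R * (1 - p%:R * e) / (1 + e) * mxform (S ^+ p.+1) y y <= \tr (S ^+ p).
Proof.
move=> pe; have [->|p_gt0] := posnP p; first by rewrite !mul0r addr0 !expr0.
have e0 : 0 <= e by rewrite (le_trans _ ye)// pS.2.
have key i j : \tr (S' ^+ i.+1 *m S ^+ j) = \tr (S' ^+ i *m S ^+ j.+1) - q i j.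
  rewrite exprSr -mulmxE -mulmxA.
  have -> : S' *m S ^+ j = S ^+ j.+1 - c *: (w *m (w^T *m S ^+ j)).
    by rewrite /S' /rank1_update -/w mulmxBl -scalemxAl -mulmxA exprS.
  rewrite mulmxBr linearB/=; congr (_ - _); rewrite -scalemxAr linearZ/=.
  congr (_ * _); transitivity (mxform (S ^+ j *m S' ^+ i) w w).
    exact: mxtrace_mul_rank1.
  by rewrite -mxform_tr trmx_mul (psdmxX _ pS).1 (psdmxX _ pS').1.
have tele k : (k <= p)%N ->
    \tr (S' ^+ k *m S ^+ (p - k)) <= \tr (S ^+ p) - k%:R * ((1 - p%:R * e) * r p.-1).
  elim: k => [_|k IH kp]; first by rewrite expr0 mul1mx subn0 mul0r subr0.
  rewrite key -subSn// subSS.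
  have := q_ge k (p - k.+1); have -> : (k + (p - k.+1))%N = p.-1 by lia.
  move=> h; have := IH (ltnW kp).
  have : r p.-1 * (1 - p%:R * e) <= r p.-1 * (1 - k%:R * e).
    by rewrite ler_wpM2l// lerD2l lerN2 ler_wpM2r// ler_nat ltnW.
  move: h; rewrite -natr1; set X := r _; set Y := q _ _.
  by set Z := \tr _; set T := \tr _; nra.
have := tele p (leqnn _); rewrite subnn expr0 mulmx1 lerBrDr; apply: le_trans.
rewrite lerD2l -!mulrA; apply: ler_wpM2l => //; apply: ler_wpM2l.
  by rewrite subr_ge0.
rewrite -[in S ^+ p.+1](prednK p_gt0).
rewrite rE /moment ler_wpM2r//; first exact: (psdmxX _ pS).2.
by rewrite /c lef_pV2 ?posrE ?ltr_wpDr ?pS.2// lerD2l.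
Qed.
End trace_decrease.

End rank1_update.

(** * Resolvents and bounds on the least eigenvalue *)

Section resolvent.
Variables (R : realFieldType) (m : nat).
Implicit Types (S A : 'M[R]_m) (a y : 'cV[R]_m).

(* On eigenvalues: the convex function p x^(p+1) - (p+1) s x^p + s^(p+1) of x >= 0
   vanishes to second order at x = s. *)
Lemma mxtrace_expr_tangent S (s : R) p : psdmx S -> 0 <= s ->
  p.+1%:R * s * \tr (S ^+ p) <= p%:R * \tr (S ^+ p.+1) + m%:R * s ^+ p.+1.
Proof.
move=> pS s0.
(* The trace of (S - s) S^k (S - s) is nonnegative. *)
have convex k : 2 * s * \tr (S ^+ k.+1) <= \tr (S ^+ k.+2) + s ^+ 2 * \tr (S ^+ k).
  have sT : (S - s%:M)^T = S - s%:M by rewrite linearB/= tr_scalar_mx pS.1.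
  have := mxtrace_psd_ge0 (psdmx_conj (S - s%:M) (psdmxX k pS)); rewrite sT.
  have -> : (S - s%:M) *m S ^+ k *m (S - s%:M) =
      S ^+ k.+2 - (2 * s) *: S ^+ k.+1 + s ^+ 2 *: S ^+ k.
    rewrite mulmxBl mul_scalar_mx mulmxE -exprS -mulmxE mulmxBr !mul_mx_scalar.
    rewrite mulmxBl -scalemxAl mulmxE -!exprSr scalerBr scalerA opprB.
    by rewrite -expr2 mulr_natl mulr2n scalerDl opprD !addrA addrAC.
  rewrite mxtraceD raddfB/= !mxtraceZ => h; rewrite -subr_ge0.
  by move: h; congr (_ <= _); ring.
elim: p => [|p IH].
  by rewrite expr0 mxtrace1 mul1r mul0r add0r expr1 mulrC.
(* In s times the induction hypothesis plus p + 1 times [convex p], the multiples of s^2 \tr (S ^+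
   p) cancel. *)
have := ler_wpM2l s0 IH.
have := ler_wpM2l (ler0n R p.+1) (convex p).
rewrite -!natr1 [s ^+ p.+2]exprS [s ^+ 2]expr2.
set x := \tr _; set z := \tr _; set t := \tr _; set v := s ^+ _.
set P := p%:R; move=> h1 h2; have {h1 h2} := lerD h1 h2; rewrite -subr_ge0 => h.
by rewrite -subr_ge0; move: h; congr (_ <= _); ring.
Qed.

(** The trace bounds the moment of order p + 1, so Jensen's inequality gives a^T S a <= |a|^2 / th.
    Cauchy-Schwarz for S between a and A a, where S A = 1, transfers this to A: |a|^4 <= (a^T S a)
    (a^T A a). *)
Lemma mxform_ge_of_trace A S (th : R) p a : 0 < th -> psdmx S -> S *m A = 1%:M ->
  A^T = A -> \tr (S ^+ p.+1) <= th ^- p.+1 ->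
  th * mxform 1%:M a a <= mxform A a a.
Proof.
move=> th0 pS SA sA Sth; set n := mxform 1%:M a a.
have n0 : 0 <= n by exact: mxform1_ge0.
have m1 : mxform S a a <= th^-1 * n.
  have h := log_convex_expr (fun k => moment_ge0 a k pS)
    (fun k => moment_log_convex a k pS) p.
  have : mxform S a a ^+ p.+1 <= (th^-1 * n) ^+ p.+1.
    move: h; rewrite /moment expr1 expr0 -/n => /le_trans; apply.
    rewrite exprMn exprVn [n ^+ p.+1]exprSr [leRHS]mulrCA.
    rewrite ler_wpM2l ?exprn_ge0//.
    by rewrite (le_trans (mxform_le_trace _ (psdmxX _ pS)))// ler_wpM2r.
  by rewrite ler_pXn2r ?nnegrE ?mulr_ge0 ?invr_ge0 ?(ltW th0) ?pS.2.
have A0 : 0 <= mxform A a a.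
  rewrite -[A]mul1mx -(mulmx1C SA) -[X in X *m _ *m _]sA.
  exact: (psdmx_conj A pS).2.
have [->|n_neq0] := eqVneq n 0; first by rewrite mulr0.
have np : 0 < n by rewrite lt_neqAle eq_sym n_neq0.
have := psdmx_CS a (A *m a) pS.
rewrite mxformMl !mxformMr SA sA -mulmxA SA mulmx1 -/n => h.
have : n * n <= n * (th^-1 * mxform A a a).
  by rewrite -expr2 (le_trans h)// mulrCA mulrA ler_wpM2r.
by rewrite ler_pM2l// mulrC ler_pdivlMr// mulrC.
Qed.

(** The solution e of the normal equations (F F^T) e = F q makes F^T e the orthogonal projection of
    q on the row space of F, so th |e|^2 <= |F^T e|^2 <= |q|^2. Invertibility holds because th > 0
    leaves no kernel. *)
Lemma mxform_solve_le m' (F : 'M[R]_(m, m')) (q : 'cV[R]_m') (th : R) :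
  0 < th -> (forall a, th * mxform 1%:M a a <= mxform (F *m F^T) a a) ->
  F *m F^T \in unitmx /\
  th * mxform 1%:M (invmx (F *m F^T) *m F *m q) (invmx (F *m F^T) *m F *m q) <=
    (q^T *m q) 0 0.
Proof.
move=> th0; set G := F *m F^T => hG.
have uG : G \in unitmx.
  rewrite -row_free_unit -kermx_eq0; apply/eqP/row_matrixP => i; rewrite row0.
  set v := row i _; have vG : v *m G = 0 by apply/sub_kermxP; exact: row_sub.
  clearbody v.
  have : th * mxform 1%:M v^T v^T <= 0.
    apply: le_trans (hG _) _.
    by rewrite /mxform trmxK -/G vG mul0mx mxE.
  rewrite pmulr_rle0// => v0.
  have {}v0 : mxform 1%:M v^T v^T = 0.
    by apply/eqP; rewrite eq_le v0 mxform1_ge0.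
  apply/rowP => j; rewrite mxE; move/eqP: v0; rewrite mxform1E.
  rewrite psumr_eq0 => [|k _]; last exact: sqr_ge0.
  by move=> /allP/(_ j (mem_index_enum _)); rewrite /= mxE sqrf_eq0 => /eqP.
split=> //; set e := invmx G *m F *m q.
have Ge : G *m e = F *m q by rewrite /e !mulmxA mulmxV// mul1mx.
clearbody e.
rewrite (le_trans (hG _))//.
have eG : mxform G e e = (e^T *m F *m q) 0 0.
  by rewrite /mxform -[in LHS]mulmxA Ge mulmxA.
have eG' : mxform G e e = mxform 1%:M (F^T *m e) (F^T *m e).
  by rewrite /mxform mulmx1 trmx_mul trmxK /G !mulmxA.
have key : mxform 1%:M (q - F^T *m e) (q - F^T *m e) =
    (q^T *m q) 0 0 - mxform G e e.
  have -> : mxform 1%:M (q - F^T *m e) (q - F^T *m e) =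
    (q^T *m q) 0 0 - 2 * (e^T *m F *m q) 0 0 + mxform 1%:M (F^T *m e) (F^T *m e).
    rewrite -[X in q - X]scale1r -scaleNr.
    rewrite mxformDl !mxformDr !mxformZl !mxformZr.
    rewrite (mxformC q _ (trmx1 _ _)) /mxform !mulmx1 trmx_mul trmxK.
    by ring.
  by rewrite -eG -eG'; ring.
by have := mxform1_ge0 (q - F^T *m e); rewrite key subr_ge0.
Qed.

Implicit Type v : nat -> 'cV[R]_m.
Variable K : R.
Hypothesis K_gt0 : 0 < K.

(** The inverse of K plus the sum of the v_i v_i^T, as [resolvent_inv] shows. The recursive form
    gives positivity, measurability and dependence on the first n vectors alone by induction. *)
Fixpoint resolvent (v : nat -> 'cV[R]_m) n : 'M[R]_m :=
  if n is n'.+1 then rank1_update (resolvent v n') (v n') else K^-1%:M.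

Lemma psdmx_resolvent v n : psdmx (resolvent v n).
Proof.
elim: n => [|n IH] /=; last exact: psdmx_rank1_update.
rewrite -scalemx1; apply: psdmx_scale; last exact: psdmx1.
by rewrite invr_ge0 ltW.
Qed.

Lemma resolvent_le v n a : mxform (resolvent v n) a a <= K^-1 * mxform 1%:M a a.
Proof.
elim: n => [|n IH] /=; last first.
  exact: le_trans (rank1_update_le _ _ (psdmx_resolvent _ _)) IH.
by rewrite -[K^-1%:M]scalemx1 mxformZm.
Qed.

Lemma resolvent_inv v n :
  (K%:M + \sum_(i < n) v i *m (v i)^T) *m resolvent v n = 1%:M.
Proof.
elim: n => [|n IH] /=.
  by rewrite big_ord0 addr0 -scalar_mxM divff// gt_eqF.
rewrite big_ord_recr/= addrA; apply: sherman_morrison => //.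
exact: psdmx_resolvent.
Qed.

End resolvent.

(** * The lower matrix Chernoff bound *)

Section past.
Context dO (Om : measurableType dO) dT (T : measurableType dT) (R : realType).
Variables (P : probability Om R) (X : nat -> {RV P >-> T}).
Implicit Types (n : nat) (A : set Om) (B : nat -> set T).

Definition cylinders n : set (set Om) :=
  [set A | exists2 B, forall i, measurable (B i) &
    A = \bigcap_(i in [set` iota 0 n]) (X i @^-1` B i)].

(* The space Om itself, with the sigma-algebra generated by X 0, ..., X n.-1. *)
Definition past n := g_sigma_algebraType (cylinders n).

Lemma cylinders_setT n : cylinders n setT.
Proof.
by exists (fun _ => setT) => //; apply/seteqP; split=> // w _ i _.
Qed.

Lemma cylinders_setI n : setI_closed (cylinders n).
Proof.
move=> _ _ [B mB ->] [C mC ->]; exists (fun i => B i `&` C i).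
  by move=> i; exact: measurableI.
by rewrite -bigcapI.
Qed.

Lemma measurable_cylinder n A : cylinders n A -> measurable A.
Proof.
move=> [B mB ->]; apply: fin_bigcap_measurable => // i _.
by rewrite -[X in measurable X]setTI; exact: measurable_funPT.
Qed.

Lemma measurable_past_set n (A : set (past n)) :
  measurable A -> measurable (A : set Om).
Proof.
apply: smallest_sub; last exact: measurable_cylinder.
exact: sigma_algebra_measurable.
Qed.

(** The identity as a measurable map to the coarser sigma-algebra; its image measure is the law of
    the past. *)
Let forget_future n : Om -> past n := id.

Let measurable_forget n : measurable_fun setT (forget_future n).
Proof. by move=> _ A mA; rewrite setTI; exact: (measurable_past_set mA). Qed.

HB.instance Definition _ n :=
  isMeasurableFun.Build _ _ _ _ (forget_future n) (@measurable_forget n).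

Lemma measurable_past n i : (i < n)%N ->
  measurable_fun setT (X i : past n -> T).
Proof.
move=> ni _ B mB; rewrite setTI; apply: sub_sigma_algebra.
exists (fun j => if j == i then B else setT); first by move=> j; case: ifP.
apply/seteqP; split=> [w Bw j _ /=|w /(_ i)/=]; first by case: eqP => [->|].
by rewrite mem_iota eqxx => /(_ ni).
Qed.

Hypothesis indepX : mutually_independent X.

(** Both sides are finite measures in A. They agree on cylinders by independence of n + 1 variables,
    and cylinders are stable under intersection. *)
Lemma past_indep n (A : set (past n)) (B : set T) :
  measurable A -> measurable B ->
  P (A `&` X n @^-1` B) = (P A * P (X n @^-1` B))%E.
Proof.
move=> mA mB.
have mXB : measurable (X n @^-1` B).
  by rewrite -[X in measurable X]setTI; exact: measurable_funPT.
pose p := fine (P (X n @^-1` B)).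
have p0 : 0 <= p by exact: fine_ge0.
have pE : P (X n @^-1` B) = p%:E by rewrite fineK// fin_num_measure.
have := @g_sigma_algebra_measure_unique _ R Om (cylinders n)
  (@measurable_cylinder n) (fun=> setT) (fun=> @cylinders_setT n) _
  (mrestr P mXB) (mscale (NngNum p0) P) (@cylinders_setI n) _ _ A mA.
rewrite /mscale/= /mrestr/= => ->.
- by rewrite muleC pE.
- by apply/seteqP; split=> // w _; exists 0%N.
- move=> _ [C mC ->].
  pose C' i := if i == n then B else C i.
  have mC' i : measurable (C' i) by rewrite /C'; case: ifP.
  have un : uniq (n :: iota 0 n) by rewrite /= iota_uniq mem_iota add0n ltnn.
  have := indepX un mC'.
  have := indepX (iota_uniq 0 n) mC.
  have C'n : C' n = B by rewrite /C' eqxx.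
  rewrite big_cons C'n pE.
  rewrite (_ : \prod_(j <- iota 0 n) P (X j @^-1` C' j) =
     \prod_(j <- iota 0 n) P (X j @^-1` C j))%E; last first.
    apply: eq_big_seq => j; rewrite mem_iota add0n => jn.
    by rewrite /C' lt_eqF.
  move=> <- indepn; apply: etrans indepn; congr (P _).
  apply/seteqP; split=> [w [Cw Bw] j /=|w Cw].
    rewrite in_cons /C'; case: eqVneq => [->//|jn /= jI]; exact: Cw.
  split=> [j jI|]; last by have /= := Cw n (mem_head _ _); rewrite C'n.
  have := Cw j; rewrite /= in_cons jI orbT /C' => /(_ isT).
  by move: jI; rewrite /= mem_iota add0n => /ltn_eqF ->.
- by move=> _; rewrite /mrestr setTI pE ltry.
Qed.

Local Open Scope ereal_scope.

(** By independence the joint law of the past and of X n is the product of their laws, so Tonelli's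
    theorem applies. *)
Lemma integral_past_next n (h : past n * T -> \bar R) :
  measurable_fun setT h -> (forall z, 0 <= h z) ->
  \int[P]_w h (w, X n w) = \int[P]_w \int[distribution P (X n)]_x h (w, x).
Proof.
move=> mh h0.
have mpair : measurable_fun setT
    ((fun w : Om => (forget_future n w, X n w)) : Om -> past n * T).
  by apply: measurable_fun_pair => //; exact: measurable_funPT.
pose J : {mfun Om >-> (past n * T)%type} := mfun_Sub (mem_set mpair).
transitivity (\int[distribution P J]_z h z).
  by rewrite ge0_integral_distribution.
pose P1 : probability _ R := distribution P (forget_future n).
pose P2 : probability _ R := distribution P (X n).
transitivity (\int[P1 \x P2]_z h z).
  apply/esym/eq_measure_integral => E mE _; apply: product_measure_unique => //.
  by move=> A B mA mB; apply: (past_indep mA mB).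
rewrite (@fubini_tonelli1 _ _ _ _ _ P1 P2)// ge0_integral_distribution//.
- exact: measurable_fun_fubini_tonelli_F.
- by move=> z; apply: integral_ge0.
Qed.

End past.

(** * Measurability of matrix-valued functions *)

Section mxmeasurable.
Context d (T : measurableType d) (R : realType).

Definition mxmeasurable m n (F : T -> 'M[R]_(m, n)) :=
  forall i j, measurable_fun setT (fun x => F x i j).

Lemma mxmeasurableM m n p (F : T -> 'M[R]_(m, n)) (G : T -> 'M[R]_(n, p)) :
  mxmeasurable F -> mxmeasurable G -> mxmeasurable (fun x => F x *m G x).
Proof.
move=> mF mG i j; under eq_fun do rewrite mxE.
by apply: measurable_sum => k; exact: measurable_funM.
Qed.

Lemma mxmeasurable_tr m n (F : T -> 'M[R]_(m, n)) :
  mxmeasurable F -> mxmeasurable (fun x => (F x)^T).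
Proof. by move=> mF i j; under eq_fun do rewrite mxE; exact: mF. Qed.

Lemma mxmeasurableX m (F : T -> 'M[R]_m) k :
  mxmeasurable F -> mxmeasurable (fun x => F x ^+ k).
Proof.
move=> mF; elim: k => [|k IH]; first by move=> i j; exact: measurable_cst.
by under eq_fun do rewrite exprS; exact: mxmeasurableM.
Qed.

Lemma mxmeasurable_trace m (F : T -> 'M[R]_m) :
  mxmeasurable F -> measurable_fun setT (fun x => \tr (F x)).
Proof. by move=> mF; apply: measurable_sum => i; exact: mF. Qed.

Lemma mxmeasurable_form m (F : T -> 'M[R]_m) (a b : T -> 'cV[R]_m) :
  mxmeasurable F -> mxmeasurable a -> mxmeasurable b ->
  measurable_fun setT (fun x => mxform (F x) (a x) (b x)).
Proof.
move=> mF ma mb; apply: (mxmeasurableM (mxmeasurableM _ mF) mb).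
exact: mxmeasurable_tr.
Qed.

Lemma mxmeasurable_rank1_update m (F : T -> 'M[R]_m) (y : T -> 'cV[R]_m) :
  (forall x, psdmx (F x)) -> mxmeasurable F -> mxmeasurable y ->
  mxmeasurable (fun x => rank1_update (F x) (y x)).
Proof.
move=> pF mF my i j; rewrite /rank1_update; under eq_fun do rewrite !mxE.
apply: measurable_funB => //; apply: measurable_funM.
  have posc x : 0 <= 1 + mxform (F x) (y x) (y x).
    by rewrite addr_ge0// (pF x).2.
  under eq_fun do rewrite -powR_inv1//.
  apply: (@measurableT_comp _ _ _ _ _ _ (@powR R ^~ (-1))).
    exact: measurable_powR.
  by apply: measurable_funD => //; exact: mxmeasurable_form.
have mFy : mxmeasurable (fun x => F x *m y x) by exact: mxmeasurableM.
apply: measurable_sum => k; under eq_fun do rewrite [_^T _ _]mxE.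
apply: measurable_funM; exact: mFy.
Qed.

End mxmeasurable.

Lemma bernoulli_decrease (R : realFieldType) (s : R) p : 0 <= s ->
  (1 - p%:R * s) * (1 + s) ^+ p <= 1.
Proof.
move=> s0; elim: p => [|p IH]; first by rewrite mul0r subr0 expr0 mulr1.
rewrite exprS mulrA (le_trans _ IH)// ler_wpM2r ?exprn_ge0 ?addr_ge0//.
rewrite -natr1; have := mulr_ge0 (ler0n R p) (mulr_ge0 s0 s0).
by have := mulr_ge0 s0 s0; set P := p%:R; nra.
Qed.

Lemma integral_cst_probability d (T : measurableType d) (R : realType)
  (P : probability T R) (c : \bar R) : (\int[P]_x c = c)%E.
Proof. by rewrite integral_cst// [X in (_ * X)%E]probability_setT mule1. Qed.

(** * The expected trace of powers of the resolvent *)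

Section resolvent_expectation.
Context dO (Om : measurableType dO) dT (T : measurableType dT) (R : realType).
Variables (P : probability Om R) (X : nat -> {RV P >-> T}).
Hypothesis indepX : mutually_independent X.
Variables (m : nat) (f : 'I_m -> T -> R) (L K : R) (p : nat).
Hypothesis mf : forall k, measurable_fun setT (f k).
Hypothesis f_le : forall x, \sum_k f k x ^+ 2 <= L.
Hypothesis f_ortho : forall n k l,
  (\int[distribution P (X n)]_x (f k x * f l x)%:E)%E = (k == l)%:R%:E.
Hypothesis K_gt0 : 0 < K.
Hypothesis pLK : p%:R * (L / K) <= 4^-1.
Hypothesis pK : p.+1%:R <= K.
Hypothesis p_gt0 : (0 < p)%N.

Let y (x : T) : 'cV[R]_m := \col_k f k x.
Let Res n (w : Om) := resolvent K (fun i => y (X i w)) n.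

Let my : mxmeasurable y.
Proof. by move=> i j; rewrite /y; under eq_fun do rewrite mxE; exact: mf. Qed.

Let yy x : mxform 1%:M (y x) (y x) <= L.
Proof. by rewrite mxform1E; under eq_bigr do rewrite mxE. Qed.

Let f2 k x : f k x ^+ 2 <= L.
Proof.
by rewrite (le_trans _ (f_le x))// (bigD1 k)//= lerDl sumr_ge0// => i _;
  exact: sqr_ge0.
Qed.

Let L_ge0 : 0 <= L.
Proof. by rewrite (le_trans _ (yy point))// mxform1_ge0. Qed.

Let integrable_ff n k l :
  (distribution P (X n)).-integrable setT (fun x => (f k x * f l x)%:E).
Proof.
have bnd : [bounded f k x * f l x | x in [set: T]].
  exists L; split; first exact: num_real.
  move=> M LM x _ /=; rewrite (le_trans _ (ltW LM))//.
  have := f2 k x; have := f2 l x; rewrite normrM.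
  rewrite -real_normK ?num_real// -[f k x ^+ 2]real_normK ?num_real//.
  set u := `|_|; set v := `|_|; have := sqr_ge0 (u - v); nra.
apply: (@measurable_bounded_integrable _ _ _ _ (fun x => f k x * f l x)) => //.
- by rewrite -ge0_fin_numE// fin_num_measure.
- exact: measurable_funM.
Qed.

(** Isotropy: the mean of y y^T is the identity. *)
Lemma integral_form_ortho n (S : 'M[R]_m) :
  (distribution P (X n)).-integrable setT (fun x => (mxform S (y x) (y x))%:E) /\
  (\int[distribution P (X n)]_x (mxform S (y x) (y x))%:E)%E = (\tr S)%:E.
Proof.
have -> : (fun x => (mxform S (y x) (y x))%:E) =
   (fun x => \sum_i \sum_j (S i j)%:E * (f i x * f j x)%:E)%E.
  apply/funext => x; rewrite mxformE -sumEFin; apply: eq_bigr => i _.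
  rewrite -sumEFin; apply: eq_bigr => j _; rewrite !mxE -EFinM; congr EFin.
  by rewrite mulrAC mulrC.
have iS i j : (distribution P (X n)).-integrable setT
    (fun x => (S i j)%:E * (f i x * f j x)%:E)%E.
  by apply: integrableZl => //; exact: integrable_ff.
have iSS i : (distribution P (X n)).-integrable setT
    (fun x => \sum_j (S i j)%:E * (f i x * f j x)%:E)%E.
  by apply: integrable_sum => // j _; exact: iS.
split; first by apply: integrable_sum => // i _; exact: iSS.
rewrite integral_sum// -sumEFin; apply: eq_bigr => i _.
rewrite integral_sum//.
under eq_bigr => j _ do rewrite (integralZl measurableT (integrable_ff _ _ _)) f_ortho.
rewrite (bigD1 i)//= eqxx mule1 big1 ?adde0// => j ji.
by rewrite eq_sym (negbTE ji) mule0.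
Qed.

(** The eigenvalue of the inverse of K + n / 2: each step is credited with half of the identity, the
    mean of y y^T. *)
Let s n : R := (K + n%:R / 2)^-1.

Let s_gt0 n : 0 < s n.
Proof. by rewrite invr_gt0 ltr_wpDr// divr_ge0. Qed.

Let sS n : s n.+1 = s n / (1 + s n / 2).
Proof.
rewrite /s -natr1; set a := K + n%:R / 2.
have a0 : 0 < a by rewrite ltr_wpDr// divr_ge0.
have -> : K + (n%:R + 1) / 2 = a + 2^-1 by rewrite /a; field.
by rewrite [RHS]mulrC -invfM mulrDl mul1r mulrAC mulVf ?gt_eqF// mul1r.
Qed.

Let s_le n : s n <= K^-1.
Proof. by rewrite lef_pV2 ?posrE// ?ltr_wpDr ?divr_ge0// lerDl divr_ge0. Qed.

(** The mean of [mxtrace_rank1_update] contains the trace of S^(p+1). The tangent inequality at t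
    replaces it by an affine function of the trace of S^p, so that the bound can be iterated under
    expectation. *)
Let trace_step n (S : 'M[R]_m) t : psdmx S ->
  (forall a, mxform S a a <= K^-1 * mxform 1%:M a a) -> 0 <= t ->
  (\int[distribution P (X n)]_x (\tr (rank1_update S (y x) ^+ p))%:E <=
    ((1 - p.+1%:R * t / 2) * \tr (S ^+ p) + m%:R * t ^+ p.+1 / 2)%:E)%E.
Proof.
move=> pS SK t0; set e := L / K.
have e0 : 0 <= e by rewrite divr_ge0// ltW.
have e4 : e <= 4^-1.
  by rewrite (le_trans _ pLK)// ler_peMl// ler1n.
pose g := p%:R * (1 - p%:R * e) / (1 + e).
(* As p e <= 1/4 and e <= 1/4, the factor (1 - p e) / (1 + e) is at least 3/5. *)
have g0 : p%:R / 2 <= g.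
  rewrite /g -mulrA ler_wpM2l// ler_pdivlMr ?ltr_wpDr//.
  by move: pLK; rewrite -/e; set q := p%:R * e; lra.
have [iS ES] := integral_form_ortho n (S ^+ p.+1).
have mS : measurable_fun setT (fun x => \tr (rank1_update S (y x) ^+ p)).
  apply: mxmeasurable_trace; apply: mxmeasurableX.
  by apply: mxmeasurable_rank1_update => // i j; exact: measurable_cst.
have icst : (distribution P (X n)).-integrable setT (cst (\tr (S ^+ p))%:E).
  exact: finite_measure_integrable_cst.
have ig : (distribution P (X n)).-integrable setT
    (fun x => (g%:E * (mxform (S ^+ p.+1) (y x) (y x))%:E)%E).
  exact: integrableZl.
apply: (@le_trans _ _ (\int[distribution P (X n)]_x
    ((\tr (S ^+ p))%:E - g%:E * (mxform (S ^+ p.+1) (y x) (y x))%:E))%E).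
  apply: ge0_le_integral => //.
  - move=> x _; rewrite lee_fin mxtrace_psd_ge0//.
    by apply: psdmxX; exact: psdmx_rank1_update.
  - exact/measurable_EFinP.
  - apply: emeasurable_funB; first exact: measurable_cst.
    exact: (measurable_int _ ig).
  - move=> x _; rewrite -EFinM -EFinB lee_fin lerBrDr.
    apply: mxtrace_rank1_update => //.
      by rewrite (le_trans (SK _))// mulrC ler_wpM2r// invr_ge0 ltW.
    by rewrite (le_trans pLK)// invf_le1// ler1n.
rewrite integralB// integral_cst_probability.
rewrite integralZl// ES -EFinM -EFinB lee_fin.
have t1 := mxtrace_expr_tangent p pS t0.
have t2 : 0 <= \tr (S ^+ p.+1) by rewrite mxtrace_psd_ge0//; exact: psdmxX.
have {}g0 := ler_wpM2r t2 g0.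
move: t1 g0; set u := \tr _; set v := \tr _; set w := t ^+ _.
by set q := p.+1%:R; set p' := p%:R; set m' := m%:R; set gu := g * u; lra.
Qed.

Let measurable_resolvent_past n k : (n <= k)%N ->
  @mxmeasurable _ (past X k) R m m (Res n).
Proof.
elim: n => [|n IH] nk; first by move=> i j; exact: measurable_cst.
apply: mxmeasurable_rank1_update; first by move=> w; exact: psdmx_resolvent.
  by move=> i j; apply: IH; exact: ltnW.
move=> i j; apply: (@measurableT_comp _ _ _ _ _ _ (fun x => y x i j)) => //.
exact: measurable_past.
Qed.

Lemma measurable_trace_resolvent n :
  measurable_fun setT (fun w : Om => \tr (Res n w ^+ p)).
Proof.
have h : measurable_fun setT ((fun w => \tr (Res n w ^+ p)) : past X n -> R).
  by apply/mxmeasurable_trace/mxmeasurableX; exact: measurable_resolvent_past.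
move=> mT B mB; rewrite setTI.
by have := h measurableT B mB; rewrite setTI => /measurable_past_set.
Qed.

Let Res_ge0 n w : 0 <= \tr (Res n w ^+ p).
Proof. by rewrite mxtrace_psd_ge0//; apply: psdmxX; exact: psdmx_resolvent. Qed.

Local Open Scope ereal_scope.

(* m * s n ^+ p is a supersolution of the recursion obtained from [trace_step] at
   the tangency point t = s n, by Bernoulli's inequality. *)
Lemma expectation_trace_resolvent n :
  \int[P]_w (\tr (Res n w ^+ p))%:E <= (m%:R * s n ^+ p)%:E.
Proof.
elim: n => [|n IH].
  have e q w : (Res 0 w ^+ q = (s 0 ^+ q)%:M)%R.
    rewrite /Res/= /s mul0r addr0; elim: q => // q IHq.
    by rewrite exprS IHq exprS scalar_mxM.
  under eq_integral do rewrite e mxtrace_scalar.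
  by rewrite integral_cst_probability mulr_natl.
pose h (z : past X n * T) : \bar R :=
  (\tr (rank1_update (Res n z.1) (y z.2) ^+ p))%:E.
have mh : measurable_fun setT h.
  apply/measurable_EFinP/mxmeasurable_trace/mxmeasurableX.
  apply: mxmeasurable_rank1_update => [z|i j|i j].
  - exact: psdmx_resolvent.
  - apply: measurableT_comp (measurable_resolvent_past _ i j) measurable_fst => //.
  - exact: measurableT_comp (my i j) measurable_snd.
have h0 z : 0 <= h z.
  rewrite lee_fin mxtrace_psd_ge0//; apply/psdmxX/psdmx_rank1_update.
  exact: psdmx_resolvent.
rewrite [leLHS](integral_past_next indepX mh h0).
pose al : R := (1 - p.+1%:R * s n / 2)%R.
pose be : R := (m%:R * s n ^+ p.+1 / 2)%R.
(* The induction hypothesis is multiplied by [al], so its sign matters; p + 1 <= K ensures it. *)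
have al0 : (0 <= al)%R.
  rewrite subr_ge0 ler_pdivrMr// mul1r.
  rewrite (@le_trans _ _ 1%R)//; last by rewrite ler1n.
  by rewrite (le_trans (ler_wpM2l _ (s_le n)))// ler_pdivrMr// mul1r.
have be0 : (0 <= be)%R by rewrite divr_ge0// mulr_ge0// exprn_ge0// ltW.
have mtr := measurable_trace_resolvent n.
apply: (@le_trans _ _ (\int[P]_w (al%:E * (\tr (Res n w ^+ p))%:E + be%:E))).
  apply: ge0_le_integral => //.
  - by move=> w _; exact: integral_ge0.
  - move=> mT B mB; rewrite setTI.
    have := measurable_fun_fubini_tonelli_F (m2 := distribution P (X n)) h mh h0.
    by move=> /(_ measurableT B mB); rewrite setTI => /measurable_past_set.
  - apply: emeasurable_funD; last exact: measurable_cst.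
    by apply: measurable_funeM; exact/measurable_EFinP.
  - move=> w _; rewrite -EFinM -EFinD.
    have tn := trace_step n (psdmx_resolvent K_gt0 (fun i => y (X i w)) n).
    have {}tn := tn _ (resolvent_le K_gt0 _ n) (ltW (s_gt0 n)).
    by rewrite /h/=; apply: (le_trans tn); rewrite lee_fin.
rewrite ge0_integralD//; last 2 first.
- by move=> w _; rewrite mule_ge0 ?lee_fin.
- by apply: measurable_funeM; exact/measurable_EFinP.
rewrite ge0_integralZl//; last 2 first.
- exact/measurable_EFinP.
- by move=> w _; rewrite lee_fin.
rewrite integral_cst_probability.
apply: (@le_trans _ _ (al%:E * (m%:R * s n ^+ p)%:E + be%:E)).
  by rewrite leeD2r// lee_wpmul2l// lee_fin.
rewrite -EFinM -EFinD lee_fin sS expr_div_n.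
have -> : (al * (m%:R * s n ^+ p) + be = m%:R * (s n ^+ p * (1 - p%:R * (s n / 2))))%R.
  by rewrite /al /be exprS -natr1; field.
rewrite ler_wpM2l// ler_wpM2l ?exprn_ge0 ?(ltW (s_gt0 n))//.
have sn0 := s_gt0 n.
rewrite -[leRHS]mul1r ler_pdivlMr ?exprn_gt0 ?addr_gt0 ?divr_gt0//.
by apply: bernoulli_decrease; rewrite divr_ge0// ltW.
Qed.

Lemma resolvent_tail (th : R) n : (0 < th)%R ->
  P [set w | ~~ (\tr (Res n w ^+ p) <= th ^- p)%R] <=
    (m%:R * (th / (K + n%:R / 2)) ^+ p)%:E.
Proof.
move=> th0; set E := [set w | _].
have mtr := measurable_trace_resolvent n.
have mE : measurable E.
  rewrite (_ : E = (fun w => \tr (Res n w ^+ p)) @^-1` `](th ^- p), +oo[%classic).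
    by rewrite -[X in measurable X]setTI; apply: mtr.
  by apply/seteqP; split=> w /=; rewrite in_itv/= andbT ltNge.
have : (th ^- p)%:E * P E <= (m%:R * s n ^+ p)%:E.
  apply: le_trans (expectation_trace_resolvent n).
  rewrite -(setIT E) -integral_indic// -ge0_integralZl//; last 2 first.
  - exact/measurable_EFinP.
  - by rewrite lee_fin invr_ge0 exprn_ge0// ltW.
  apply: ge0_le_integral => //.
  - by move=> w _; rewrite mule_ge0// lee_fin// invr_ge0 exprn_ge0// ltW.
  - by apply: measurable_funeM; exact/measurable_EFinP.
  - exact/measurable_EFinP.
  - move=> w _; rewrite -EFinM lee_fin indicE.
    have [wE|_] := boolP (w \in E); last by rewrite mulr0.
    by rewrite mulr1; move: wE; rewrite inE /E /= -ltNge => /ltW.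
have thp : (0 < th ^- p)%R by rewrite invr_gt0 exprn_gt0.
rewrite -lee_pdivlMl// => /le_trans; apply.
by rewrite -EFinM lee_fin invrK mulrCA exprMn.
Qed.

End resolvent_expectation.

(** * Elementary estimates for logarithms and series *)

(** Since ln M = 2 ln (sqrt M) <= 2 sqrt M, the left side is at most 3 c sqrt M for M >= 1, and
    eventually 3 c <= sqrt M. *)
Lemma ln_near_linear (R : realType) (c : R) :
  \forall M \near \oo, c * (1 + ln M%:R) <= M%:R.
Proof.
wlog c0 : c / 0 <= c.
  move=> H; apply: filterS (H `|c| (normr_ge0 c)) => M; apply: le_trans.
  case: M => [|M]; first by rewrite ln0// addr0 ler_wpM2r// ler_norm.
  by rewrite ler_wpM2r ?ler_norm// addr_ge0// ln_ge0// ler1n.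
near=> M.
have hM : 1 + 9 * c ^+ 2 <= M%:R by near: M; exact: nbhs_infty_ger.
have M0 : 0 < M%:R :> R.
  by rewrite (lt_le_trans _ hM)// ltr_wpDr// mulr_ge0 ?sqr_ge0.
set s := Num.sqrt (M%:R : R).
have s0 : 0 < s by rewrite sqrtr_gt0.
have sE : M%:R = s ^+ 2 by rewrite sqr_sqrtr// ltW.
have ls : ln (M%:R : R) <= 2 * s.
  by rewrite sE lnXn// -[ln s *+ 2]mulr_natl ler_wpM2l// ltW// ln_sublinear.
have s1 : 1 <= s.
  rewrite -(ler_pXn2r (n := 2))// ?nnegrE ?(ltW s0)// expr1n -sE.
  by rewrite (le_trans _ hM)// lerDl mulr_ge0 ?sqr_ge0.
have sc : 3 * c <= s.
  rewrite -(ler_pXn2r (n := 2))// ?nnegrE ?(ltW s0) ?mulr_ge0//.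
  rewrite -sE (le_trans _ hM)// exprMn (_ : 3 ^+ 2 = 9 :> R) ?lerDr//.
  by rewrite expr2 -natrM.
have : c * (1 + ln (M%:R : R)) <= c * (3 * s).
  by apply: ler_wpM2l => //; move: s1 ls; lra.
move/le_trans; apply; rewrite sE expr2 mulrCA mulrA.
by rewrite ler_wpM2r// ltW.
Unshelve. all: by end_near. Qed.

(** As ln 2 >= 1/2, the logarithm without its rounding unit is at most 2 ln M, and the unit itself
    is at most 2 ln M. *)
Lemma up_log_le (R : realType) M : (1 < M)%N ->
  (up_log 2 M)%:R <= 4 * ln (M%:R : R).
Proof.
move=> M1; have /andP[lo _] := up_log_bounds (ltnSn 1) M1.
have ln2 : 2^-1 <= ln 2 :> R.
  have h : -1 < - 2^-1 :> R by rewrite ltrN2 invf_lt1// ltr1n.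
  have := le_ln1Dx h; have -> : 1 + - 2^-1 = 2^-1 :> R by field.
  by rewrite lnV ?posrE// lerN2.
have u0 : (0 < up_log 2 M)%N by rewrite up_log_gt0.
have l1 : (up_log 2 M).-1%:R * ln 2 <= ln (M%:R : R).
  rewrite mulr_natl -lnXn// ler_ln ?posrE ?exprn_gt0// ?ltr0n ?(ltnW M1)//.
  by rewrite -natrX ler_nat ltnW.
have l2 : ln 2 <= ln (M%:R : R).
  by rewrite ler_ln ?posrE ?ltr0n ?(ltnW M1)// ler_nat.
have l3 : (up_log 2 M).-1%:R * 2^-1 <= (up_log 2 M).-1%:R * ln 2 :> R.
  exact: ler_wpM2l.
rewrite -(prednK u0) -natr1.
move: l1 l2 l3 ln2; set a := _.-1%:R; set b := a * ln 2; lra.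
Qed.

Lemma nneseries_telescope_lty (R : realType) (u : nat -> \bar R) (c : R) :
  0 <= c -> (forall n, 0 <= u n)%E ->
  (forall n, u n <= (c * (n.+1%:R^-1 - n.+2%:R^-1))%:E)%E ->
  (\sum_(0 <= n <oo) u n < +oo)%E.
Proof.
move=> c0 u0 uc; apply: (@le_lt_trans _ _ c%:E); last exact: ltry.
apply: lime_le; first by apply: is_cvg_nneseries => n _ _; exact: u0.
apply: nearW => n.
apply: (@le_trans _ _ (\sum_(0 <= i < n) (c * (i.+1%:R^-1 - i.+2%:R^-1))%:E)%E).
  by apply: lee_sum => i _; exact: uc.
rewrite sumEFin lee_fin -mulr_sumr ler_piMr//.
under eq_bigr => i _ do rewrite -opprB.
rewrite sumrN (telescope_sumr (fun i => (i.+1%:R : R)^-1))// opprB invr1.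
by rewrite gerBl.
Qed.

(** * Almost sure lower bound for the sampled Gram matrices *)

Section sampling.
Context dO (Om : measurableType dO) dT (T : measurableType dT) (R : realType).
Variables (P : probability Om R) (X : nat -> {RV P >-> T}).
Hypothesis indepX : mutually_independent X.
Variables (f : nat -> T -> R) (b : R) (m : nat -> nat).
Hypothesis mf : forall k, measurable_fun setT (f k).
Hypothesis f_le : forall k x, f k x ^+ 2 <= b.
Hypothesis f_ortho : forall n k l,
  (\int[distribution P (X n)]_x (f k x * f l x)%:E)%E = (k == l)%:R%:E.
Hypothesis hm : \forall M \near \oo, (m M <= M)%N /\
  400 * b * (m M)%:R * ln M%:R <= M%:R.

Lemma sampling_lower_bound :
  {ae P, forall w, \forall M \near \oo, forall a : 'cV[R]_(m M),
    M%:R / 8 * mxform 1%:M a a <=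
    mxform (\sum_(j < M) (\col_k f k (X j w)) *m (\col_k f k (X j w))^T) a a}.
Proof.
(* With K = M / 8 and threshold M / 4 the ratio in [resolvent_tail] is
   (M / 4) / (M / 8 + M / 2) = 2 / 5, so its p-th power is at most M ^- 3. *)
pose p M := (3 * up_log 2 M)%N.
pose Res M (w : Om) :=
  resolvent (M%:R / 8) (fun i => \col_(k < m M) f k (X i w)) M.
pose E M := [set w | ~~ (\tr (Res M w ^+ p M) <= (M%:R / 4) ^- p M)].
(* The last clause serves twice: for p + 1 <= M / 8 and for M >= 4. *)
have [N0 _ hN0] : \forall M \near \oo, [/\ (1 < M)%N, (m M <= M)%N,
    400 * b * (m M)%:R * ln M%:R <= M%:R & 200 * (1 + ln (M%:R : R)) <= M%:R].
  near=> M; have [] : (m M <= M)%N /\ 400 * b * (m M)%:R * ln M%:R <= M%:R.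
    by near: M.
  split=> //; first by near: M; exact: nbhs_infty_gt.
  by near: M; exact: ln_near_linear.
have b0 : 0 <= b by rewrite (le_trans _ (f_le 0%N point))// sqr_ge0.
have mE M : (0 < M)%N -> measurable (E M).
  move=> M0; have K0 : 0 < M%:R / 8 :> R by rewrite divr_gt0// ltr0n.
  have mtr := @measurable_trace_resolvent _ _ _ _ _ P X _
    (fun k : 'I_(m M) => f k) _ (p M) (fun k => mf k) K0 M.
  rewrite (_ : E M = (fun w => \tr (Res M w ^+ p M)) @^-1`
      `]((M%:R / 4) ^- p M), +oo[%classic).
    by rewrite -[X in measurable X]setTI; apply: mtr.
  by apply/seteqP; split=> w /=; rewrite in_itv/= andbT ltNge.
have PE M : (N0 <= M)%N -> (P (E M) <= (2 * (M.+1%:R^-1 - M.+2%:R^-1))%:E)%E.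
  move=> NM; have [M1 mM bM lnM] := hN0 M NM.
  have M0 : 0 < M%:R :> R by rewrite ltr0n ltnW.
  have K0 : 0 < M%:R / 8 :> R by rewrite divr_gt0.
  have p0 : (0 < p M)%N by rewrite /p muln_gt0 up_log_gt0.
  have th0 : 0 < M%:R / 4 :> R by rewrite divr_gt0.
  have u_le := up_log_le R M1.
  have ln0 : 0 <= ln (M%:R : R) by rewrite ln_ge0// ler1n ltnW.
  have sum_le x : \sum_(k < m M) f k x ^+ 2 <= (m M)%:R * b.
    rewrite (@le_trans _ _ (\sum_(k < m M) b))//; first by apply: ler_sum => k _.
    by rewrite sumr_const card_ord mulr_natl.
  (* With p <= 12 ln M and K = M / 8 the claim asks for 384 b m ln M <= M, which the factor 400 in
     [hm] covers. *)
  have pLK : (p M)%:R * ((m M)%:R * b / (M%:R / 8)) <= 4^-1 :> R.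
    rewrite invf_div !mulrA ler_pdivrMr// /p natrM.
    have : (up_log 2 M)%:R * ((m M)%:R * b) <= 4 * ln M%:R * ((m M)%:R * b) :> R.
      by rewrite ler_wpM2r// mulr_ge0.
    have := mulr_ge0 (mulr_ge0 b0 (ler0n R (m M))) ln0.
    by move: bM; set q := (m M)%:R; set l := ln _; set u := (up_log 2 M)%:R; lra.
  have pK : (p M).+1%:R <= M%:R / 8 :> R.
    rewrite -natr1 /p natrM ler_pdivlMr//.
    by move: u_le lnM ln0; set l := ln _; set u := _%:R; lra.
  have := resolvent_tail indepX (fun k : 'I_(m M) => mf k) sum_le
    (fun n k l => f_ortho n k l) K0 pLK pK p0 M th0.
  move/le_trans; apply; rewrite lee_fin.
  have -> : M%:R / 4 / (M%:R / 8 + M%:R / 2) = 2 / 5 :> R.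
    by field; rewrite gt_eqF// addr_gt0// mulr_gt0.
  have M4 : 4 <= M%:R :> R by move: lnM ln0; set l := ln _; lra.
  apply: (@le_trans _ _ (M%:R * (M%:R^-1 ^+ 3))).
    apply: ler_pM => //; rewrite ?ler_nat// ?exprn_ge0//.
    apply: (@le_trans _ _ (2^-1 ^+ p M)).
      by rewrite ler_pXn2r ?nnegrE// ler_pdivrMr//; lra.
    rewrite /p mulnC exprM ler_pXn2r ?nnegrE ?exprn_ge0 ?invr_ge0//.
    rewrite exprVn lef_pV2 ?posrE ?exprn_gt0// -natrX ler_nat.
    by have /andP[] := up_log_bounds (ltnSn 1) M1.
  (* It remains to compare M^-2 with the telescoping term 2 / ((M + 1) (M + 2)), which is larger
     once M >= 4. *)
  rewrite -[M.+2%:R]natr1 -[M.+1%:R]natr1; move: M0 M4; set x := M%:R => x0 x4.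
  have -> : x * x^-1 ^+ 3 = (x ^+ 2)^-1 by field; rewrite gt_eqF.
  have -> : 2 * ((x + 1)^-1 - (x + 1 + 1)^-1) = (2^-1 * (x + 1) * (x + 1 + 1))^-1.
    by field; rewrite !gt_eqF ?addr_gt0.
  rewrite lef_pV2 ?posrE ?exprn_gt0 ?mulr_gt0 ?addr_gt0 ?invr_gt0//.
  by nra.
(* Empty below [N0], so that the summable bound holds at every index. *)
pose F M := if (N0 <= M)%N then E M else set0.
have mF M : measurable (F M).
  rewrite /F; case: ifPn => // NM; apply: mE.
  by have [+ _ _ _] := hN0 M NM; exact: ltnW.
have PF M : (P (F M) <= (2 * (M.+1%:R^-1 - M.+2%:R^-1))%:E)%E.
  rewrite /F; case: ifPn => [|_]; first exact: PE.
  by rewrite measure0 lee_fin mulr_ge0// subr_ge0 lef_pV2 ?posrE// ler_nat.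
have F0 : P (lim_sup_set F) = 0%E.
  apply: lim_sup_set_cvg0 => //.
  by apply: (@nneseries_telescope_lty R _ 2) => // n; exact: PF.
exists (lim_sup_set F); split => //.
  by apply: bigcapT_measurable => n; apply: bigcup_measurable => k _; exact: mF.
move=> w; apply: contra_notP => /= wF.
have [N wN] : exists N, forall M, (N <= M)%N -> ~ F M w.
  apply: contrapT => /forallNP h; apply: wF => N _ /=.
  apply: contrapT => h'; apply: (h N) => M NM FM; apply: h'.
  by exists M.
exists (maxn N N0) => // M /=; rewrite geq_max => /andP[NM N0M] a.
have [M1 mM _ _] := hN0 M N0M.
have M0 : 0 < M%:R :> R by rewrite ltr0n ltnW.
have K0 : 0 < M%:R / 8 :> R by rewrite divr_gt0.
have := wN M NM; rewrite /F N0M /E/= => /negP; rewrite negbK => trM.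
have p0 : (0 < p M)%N by rewrite /p muln_gt0 up_log_gt0.
have th0 : 0 < M%:R / 4 :> R by rewrite divr_gt0.
pose y (i : nat) : 'cV[R]_(m M) := \col_k f k (X i w).
set Sg := \sum_(_ < _) _.
have SA : Res M w *m ((M%:R / 8)%:M + Sg) = 1%:M.
  by apply: mulmx1C; exact: (resolvent_inv K0 y M).
have sA : ((M%:R / 8)%:M + Sg)^T = (M%:R / 8)%:M + Sg.
  rewrite linearD/= tr_scalar_mx /Sg linear_sum/=; congr (_ + _).
  by apply: eq_bigr => i _; rewrite trmx_mul trmxK.
rewrite -(prednK p0) in trM.
have := mxform_ge_of_trace a th0 (psdmx_resolvent K0 y M) SA sA trM.
(* The bound M / 4 holds for K plus the sum; removing K = M / 8 leaves M / 8. *)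
rewrite mxformDm -[(M%:R / 8)%:M]scalemx1 mxformZm.
move: (mxform 1%:M a a) (mxform Sg a a) => u v.
by rewrite -lerBlDl -mulrBl (_ : M%:R / 4 - M%:R / 8 = M%:R / 8)//; field.
Unshelve. all: by end_near. Qed.

End sampling.

(** * Square-integrable functions *)

Section orthogonal_sums.
Context d (T : measurableType d) (R : realType) (mu : {measure set T -> \bar R}).

(** Serves on two spaces: for the eigenfunctions on D, with q = 1, and for the random coefficients
    under the law of u, where q is the sequence of eigenvalues. *)
Lemma integral_sqr_orthogonal (I : eqType) (psi : I -> T -> R) (q : I -> R)
    (r : seq I) (c : I -> R) :
  (forall i j, mu.-integrable setT (fun x => (psi i x * psi j x)%:E)) ->
  (forall i j, (\int[mu]_x (psi i x * psi j x)%:E)%E = (q i *+ (i == j))%:E) ->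
  uniq r ->
  mu.-integrable setT (fun x => ((\sum_(i <- r) c i * psi i x) ^+ 2)%:E) /\
  (\int[mu]_x ((\sum_(i <- r) c i * psi i x) ^+ 2)%:E)%E =
    (\sum_(i <- r) c i ^+ 2 * q i)%:E.
Proof.
move=> ipsi opsi ur.
have -> : (fun x => ((\sum_(i <- r) c i * psi i x) ^+ 2)%:E) =
    (fun x => \sum_(i <- r) \sum_(j <- r) (c i * c j)%:E * (psi i x * psi j x)%:E)%E.
  apply/funext => x; rewrite expr2 mulr_suml -sumEFin; apply: eq_bigr => i _.
  rewrite mulr_sumr -sumEFin; apply: eq_bigr => j _.
  by rewrite -EFinM mulrACA.
have i1 i j : mu.-integrable setT (fun x => (c i * c j)%:E * (psi i x * psi j x)%:E)%E.
  exact: integrableZl.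
have i2 i : mu.-integrable setT
    (fun x => \sum_(j <- r) (c i * c j)%:E * (psi i x * psi j x)%:E)%E.
  by apply: integrable_sum => // j _; exact: i1.
split; first by apply: integrable_sum => // i _; exact: i2.
rewrite integral_sum// -sumEFin; apply: eq_big_seq => i ir.
rewrite integral_sum//.
under eq_bigr => j _ do rewrite (integralZl measurableT (ipsi _ _)) opsi.
rewrite (bigD1_seq i)//= eqxx mulr1n big1 ?adde0 -?EFinM ?expr2// => j ji.
by rewrite eq_sym (negbTE ji) mulr0n mule0.
Qed.

Definition sq_integrable (f : T -> R) :=
  measurable_fun setT f /\ (\int[mu]_x (f x ^+ 2)%:E < +oo)%E.

Lemma L2norm_sqrte (f : T -> R) :
  (L2norm mu f = sqrte (\int[mu]_x (f x ^+ 2)%:E))%E.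
Proof.
rewrite -poweR12_sqrt; last first.
  by apply: integral_ge0 => x _; rewrite lee_fin sqr_ge0.
rewrite /L2norm unlock; congr poweR; apply: eq_integral => x _.
by rewrite /= powR_mulrn// real_normK ?num_real.
Qed.

Lemma L2norm_sqr (f : T -> R) :
  (L2norm mu f ^+ 2 = \int[mu]_x (f x ^+ 2)%:E)%E.
Proof.
rewrite L2norm_sqrte sqr_sqrte//.
by apply: integral_ge0 => x _; rewrite lee_fin sqr_ge0.
Qed.

Lemma L2norm_lt_sq_integrable (f : T -> R) : measurable_fun setT f ->
  (L2norm mu f < +oo)%E -> sq_integrable f.
Proof.
move=> mf fo; split => //; rewrite -L2norm_sqr.
have : L2norm mu f \is a fin_num by rewrite ge0_fin_numE// Lnorm_ge0.
by move=> /fineK <-; rewrite -EFin_expe ltry.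
Qed.

Lemma sq_integrable_lt_L2norm (f : T -> R) : sq_integrable f ->
  (L2norm mu f < +oo)%E.
Proof.
move=> [mf fo]; rewrite ltey; apply/eqP => fE.
by move: fo; rewrite -L2norm_sqr fE.
Qed.

Lemma sq_integrableZ (k : R) f : sq_integrable f -> sq_integrable (fun x => k * f x).
Proof.
move=> [mf fo]; split; first exact: measurable_funM.
have msq : measurable_fun setT (fun x => (f x ^+ 2)%:E).
  by apply/measurable_EFinP; exact: measurable_funX.
under eq_integral do rewrite exprMn EFinM.
rewrite ge0_integralZl ?lee_fin ?sqr_ge0//; last by move=> x _; rewrite lee_fin sqr_ge0.
by rewrite lte_mul_pinfty// ?lee_fin ?sqr_ge0.
Qed.

Lemma integral_sqrD_le (f g : T -> R) :
  measurable_fun setT f -> measurable_fun setT g ->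
  (\int[mu]_x ((f x + g x) ^+ 2)%:E <=
   2%:E * \int[mu]_x (f x ^+ 2)%:E + 2%:E * \int[mu]_x (g x ^+ 2)%:E)%E.
Proof.
move=> mf mg.
have msq (h : T -> R) : measurable_fun setT h ->
    measurable_fun setT (fun x => (h x ^+ 2)%:E).
  by move=> mh; apply/measurable_EFinP; exact: measurable_funX.
have sq0 (h : T -> R) (x : T) : (0 <= (h x ^+ 2)%:E)%E by rewrite lee_fin sqr_ge0.
rewrite -!ge0_integralZl//; [|exact: msq|exact: msq].
rewrite -ge0_integralD//; last 4 first.
- by move=> x _; rewrite mule_ge0.
- by apply: measurable_funeM; exact: msq.
- by move=> x _; rewrite mule_ge0.
- by apply: measurable_funeM; exact: msq.
apply: ge0_le_integral => //.
- by move=> x _; exact: (sq0 (f \+ g)).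
- by apply: (msq (f \+ g)); exact: measurable_funD.
- apply: emeasurable_funD; apply: measurable_funeM; exact: msq.
- move=> x _; rewrite -!EFinM -EFinD lee_fin.
  by have := sqr_ge0 (f x - g x); nra.
Qed.

Lemma sq_integrableD f g : sq_integrable f -> sq_integrable g ->
  sq_integrable (fun x => f x + g x).
Proof.
move=> [mf fo] [mg go]; split; first exact: measurable_funD.
apply: le_lt_trans (integral_sqrD_le mf mg) _.
by rewrite lte_add_pinfty// lte_mul_pinfty.
Qed.

Lemma sq_integrableB f g : sq_integrable f -> sq_integrable g ->
  sq_integrable (fun x => f x - g x).
Proof.
move=> sf sg; have := sq_integrableD sf (sq_integrableZ (-1) sg).
by under eq_fun do rewrite mulN1r.
Qed.

Lemma sq_integrable_sum (I : Type) (r : seq I) (f : I -> T -> R) :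
  (forall i, sq_integrable (f i)) -> sq_integrable (fun x => \sum_(i <- r) f i x).
Proof.
move=> sf; elim: r => [|i r IH].
  under eq_fun do rewrite big_nil; split; first exact: measurable_cst.
  by under eq_integral do rewrite expr0n; rewrite integral0.
by under eq_fun do rewrite big_cons; exact: sq_integrableD.
Qed.

Lemma sq_integrableM f g : sq_integrable f -> sq_integrable g ->
  mu.-integrable setT (fun x => (f x * g x)%:E).
Proof.
move=> [mf fo] [mg go].
have mfg : measurable_fun setT (fun x => (f x * g x)%:E).
  by apply/measurable_EFinP; exact: measurable_funM.
have msq (h : T -> R) : measurable_fun setT h ->
    measurable_fun setT (fun x => (h x ^+ 2)%:E).
  by move=> mh; apply/measurable_EFinP; exact: measurable_funX.
apply/integrableP; split => //.
apply: (@le_lt_trans _ _ (\int[mu]_x ((f x ^+ 2)%:E + (g x ^+ 2)%:E))%E); last first.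
  rewrite ge0_integralD//; first by rewrite lte_add_pinfty.
  - by move=> x _; rewrite lee_fin sqr_ge0.
  - exact: msq.
  - by move=> x _; rewrite lee_fin sqr_ge0.
  - exact: msq.
apply: ge0_le_integral => //.
- exact: measurableT_comp.
- by apply: emeasurable_funD; exact: msq.
- move=> x _; rewrite abse_EFin -EFinD lee_fin normrM.
  rewrite -(real_normK (num_real (f x))) -(real_normK (num_real (g x))).
  by have := sqr_ge0 (`|f x| - `|g x|); have := sqr_ge0 (`|f x| + `|g x|); nra.
Qed.

Lemma L2dot_CS f g : sq_integrable f -> sq_integrable g ->
  `|L2dot mu f g| <= fine (L2norm mu f) * fine (L2norm mu g).
Proof.
move=> sf sg; have ifg := sq_integrableM sf sg.
have [mf _] := sf; have [mg _] := sg.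
have Nf : L2norm mu f \is a fin_num.
  by rewrite ge0_fin_numE ?Lnorm_ge0// sq_integrable_lt_L2norm.
have Ng : L2norm mu g \is a fin_num.
  by rewrite ge0_fin_numE ?Lnorm_ge0// sq_integrable_lt_L2norm.
rewrite -lee_fin EFinM !fineK//.
have e2 : (2^-1 + 2^-1 = 1 :> R) by field.
apply: le_trans (hoelder mu mf mg (ltr0n _ 2) (ltr0n _ 2) e2).
rewrite Lnorm1; apply: (@le_trans _ _ `|\int[mu]_x (f x * g x)%:E|%E).
  by rewrite -EFin_normr_Rintegral.
exact: le_abse_integral (measurable_int _ ifg).
Qed.

Lemma L2dotZl k f g : sq_integrable f -> sq_integrable g ->
  L2dot mu (fun x => k * f x) g = k * L2dot mu f g.
Proof.
move=> sf sg; rewrite /L2dot -RintegralZl//; last exact: sq_integrableM.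
by apply: eq_Rintegral => x _; rewrite mulrA.
Qed.

Lemma L2dotBl f g h : sq_integrable f -> sq_integrable g -> sq_integrable h ->
  L2dot mu (fun x => f x - g x) h = L2dot mu f h - L2dot mu g h.
Proof.
move=> sf sg sh; rewrite /L2dot -RintegralB//; [|exact: sq_integrableM..].
by apply: eq_Rintegral => x _; rewrite mulrBl.
Qed.

Lemma L2dot_suml (I : Type) (r : seq I) (c : I -> R) (psi : I -> T -> R) h :
  (forall i, sq_integrable (psi i)) -> sq_integrable h ->
  L2dot mu (fun x => \sum_(i <- r) c i * psi i x) h =
  \sum_(i <- r) c i * L2dot mu (psi i) h.
Proof.
move=> spsi sh; elim: r => [|i r IH].
  rewrite big_nil /L2dot; under eq_Rintegral do rewrite big_nil mul0r.
  by rewrite Rintegral_cst// mul0r.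
rewrite big_cons -IH -L2dotZl// /L2dot -RintegralD//.
- by apply: eq_Rintegral => x _; rewrite big_cons mulrDl.
- by apply: sq_integrableM => //; exact: sq_integrableZ.
- by apply: sq_integrableM => //; apply: sq_integrable_sum => j; exact: sq_integrableZ.
Qed.

Section expansion.
Variables (u : T -> R) (psi : nat -> T -> R) (c : nat -> R).
Hypotheses (su : sq_integrable u) (spsi : forall i, sq_integrable (psi i)).
Hypothesis expand :
  (fun n => L2norm mu (fun x => u x - \sum_(i < n) c i * psi i x)) @ \oo --> 0%E.

Let sS n : sq_integrable (fun x => \sum_(i < n) c i * psi i x).
Proof. by apply: sq_integrable_sum => i; exact: sq_integrableZ. Qed.

Lemma L2dot_expansion w : sq_integrable w ->
  (fun n => \sum_(i < n) c i * L2dot mu (psi i) w) @ \oo --> L2dot mu u w.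
Proof.
move=> sw; have e0 := fine_cvg expand.
apply/subr_cvg0; apply: (@norm_cvg0 _ R^o) => /=.
apply: (@squeeze_cvgr _ _ _ _ (cst 0)
  (fun n => fine (L2norm mu (fun x => u x - \sum_(i < n) c i * psi i x)) *
     fine (L2norm mu w))); last 2 first.
- exact: cvg_cst.
- by rewrite -[X in _ --> X](mul0r (fine (L2norm mu w))); apply: cvgMr_tmp; exact: e0.
apply: nearW => n; rewrite normr_ge0/=.
rewrite -(L2dot_suml (index_enum 'I_n) (fun i => c i) (fun i => spsi i) sw).
rewrite -normrN opprB -(L2dotBl su (sS n) sw).
exact: (L2dot_CS (sq_integrableB su (sS n)) sw).
Qed.

Hypothesis ortho : forall i j, L2dot mu (psi i) (psi j) = (i == j)%:R.

(** The injection h allows index lists of ordinals as well as of naturals. *)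
Lemma integral_sqr_orthonormal (I : eqType) (r : seq I) (h : I -> nat) (a : I -> R) :
  injective h -> uniq r ->
  (\int[mu]_x ((\sum_(i <- r) a i * psi (h i) x) ^+ 2)%:E)%E =
  (\sum_(i <- r) a i ^+ 2)%:E.
Proof.
move=> injh ur; have ipsi i j := sq_integrableM (spsi i) (spsi j).
have oE i j : (\int[mu]_x (psi (h i) x * psi (h j) x)%:E)%E = (1 *+ (i == j))%:E.
  rewrite -(inj_eq injh) -ortho /L2dot fineK//.
  exact: integrable_fin_num.
have [_ ->] := integral_sqr_orthogonal a (fun i j => ipsi (h i) (h j)) oE ur.
by congr EFin; apply: eq_bigr => i _; rewrite mulr1.
Qed.

(** Parseval's identity up to a factor 2, which comes from splitting the remainder at some n >= m;
    the part beyond n tends to 0 in norm. *)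
Lemma integral_sqr_remainder_le m :
  (\int[mu]_x ((u x - \sum_(i < m) c i * psi i x) ^+ 2)%:E <=
    2%:E * \sum_(m <= l <oo) (c l ^+ 2)%:E)%E.
Proof.
have key n : (m <= n)%N ->
    (\int[mu]_x ((u x - \sum_(i < m) c i * psi i x) ^+ 2)%:E <=
     2%:E * L2norm mu (fun x => (u x - \sum_(i < n) c i * psi i x)%R) ^+ 2 +
     2%:E * \sum_(m <= l <oo) (c l ^+ 2)%:E)%E.
  move=> mn.
  have e x : u x - \sum_(i < m) c i * psi i x =
      (u x - \sum_(i < n) c i * psi i x) + \sum_(m <= i < n) c i * psi i x.
    rewrite -[\sum_(i < n) _](big_mkord xpredT (fun i => c i * psi i x)).
    rewrite (@big_cat_nat _ _ _ m)//= big_mkord opprD addrA subrK.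
    by [].
  under eq_integral do rewrite e.
  have su1 := sq_integrableB su (sS n).
  have [ms _] : sq_integrable (fun x => \sum_(m <= i < n) c i * psi i x).
    by apply: sq_integrable_sum => i; exact: sq_integrableZ.
  apply: le_trans (integral_sqrD_le su1.1 ms) _.
  rewrite L2norm_sqr leeD2l// lee_wpmul2l//.
  rewrite (@integral_sqr_orthonormal _ (index_iota m n) id c)//; last exact: iota_uniq.
  rewrite -sumEFin; apply: nneseries_lim_ge => i _ _.
  by rewrite lee_fin sqr_ge0.
set S := (\sum_(m <= l <oo) _)%E in key *.
have S0 : (0 <= S)%E by apply: nneseries_ge0 => i _ _; rewrite lee_fin sqr_ge0.
have [->|Sfin] := eqVneq S +oo%E; first by rewrite gt0_muley ?lte_fin// leey.
apply/lee_addgt0Pr => e e0.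
(* A norm N below both 1 and e / 2 satisfies 2 N^2 <= 2 N <= e. *)
pose dl := Num.min 1 (e / 2).
have dl0 : 0 < dl by rewrite lt_min ltr01 divr_gt0.
have /fine_cvgP[Nfin /cvgrPdist_le/(_ _ dl0) Nle] := expand.
near \oo => n.
have mn : (m <= n)%N by near: n; exact: nbhs_infty_ge.
apply: le_trans (key n mn) _; rewrite addeC leeD2l//.
have fN : L2norm mu (fun x => u x - \sum_(i < n) c i * psi i x) \is a fin_num.
  by near: n.
have : `|0 - fine (L2norm mu (fun x => u x - \sum_(i < n) c i * psi i x))| <= dl.
  by near: n.
set N := L2norm mu _ in fN *; have NE : N = (fine N)%:E by rewrite fineK.
have N0 : 0 <= fine N by rewrite fine_ge0// Lnorm_ge0.
rewrite sub0r normrN ger0_norm// le_min => /andP[N1 Ne].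
rewrite NE -EFin_expe -EFinM lee_fin expr2.
have := ler_wpM2l N0 N1; rewrite mulr1 => h.
by rewrite mulrC -ler_pdivlMr// (le_trans h).
Unshelve. all: by end_near. Qed.

End expansion.

End orthogonal_sums.

(** * Averages over small sets and the support of a measure *)

Section averages.
Context d (T : measurableType d) (R : realType) (mu : {measure set T -> \bar R}).
Hypothesis mu_fin : (mu setT < +oo)%E.

(** The density whose pairing with a function is the mean of that function over B. *)
Definition average (B : set T) : T -> R := fun z => (fine (mu B))^-1 * \1_B z.

Lemma sq_integrable_bounded (f : T -> R) (b : R) : measurable_fun setT f ->
  (forall x, `|f x| <= b) -> sq_integrable mu f.
Proof.
move=> mf fb; split => //.
have b0 : 0 <= b by rewrite (le_trans _ (fb point)).
apply: (@le_lt_trans _ _ (\int[mu]_x (b ^+ 2)%:E)%E).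
  apply: ge0_le_integral => //.
  - by move=> x _; rewrite lee_fin sqr_ge0.
  - by apply/measurable_EFinP; exact: measurable_funX.
  - move=> x _; rewrite lee_fin -(real_normK (num_real (f x))).
    by rewrite ler_pXn2r ?nnegrE.
by rewrite integral_cst// lte_mul_pinfty// lee_fin sqr_ge0.
Qed.

Variable B : set T.
Hypotheses (mB : measurable B) (B0 : (0 < mu B)%E).

Let BE : mu B = (fine (mu B))%:E.
Proof.
rewrite fineK// ge0_fin_numE//; apply: le_lt_trans mu_fin.
by apply: le_measure; [exact: mem_set|exact: mem_set|exact: subsetT].
Qed.

Let fB0 : 0 < fine (mu B). Proof. by rewrite -lte_fin -BE. Qed.

Lemma average_ge0 x : 0 <= average B x.
Proof. by rewrite mulr_ge0// invr_ge0 ltW. Qed.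

Lemma sq_integrable_average : sq_integrable mu (average B).
Proof.
apply: (@sq_integrable_bounded _ (fine (mu B))^-1).
  by apply: measurable_funM => //; exact: measurable_indic.
move=> x; rewrite ger0_norm ?average_ge0//; apply: ler_piMr.
  by rewrite invr_ge0 ltW.
by rewrite indicE; case: (_ \in _).
Qed.

Lemma L2dot_cst_average c : L2dot mu (cst c) (average B) = c.
Proof.
have sc : sq_integrable mu (fun=> c) by apply: (@sq_integrable_bounded _ `|c|).
rewrite /L2dot /average/=.
transitivity (\int[mu]_x ((c * (fine (mu B))^-1) * \1_B x)).
  by apply: eq_Rintegral => x _; rewrite mulrA.
rewrite RintegralZl//; last first.
  apply/integrableP; split; first exact/measurable_EFinP/measurable_indic.
  under eq_integral do rewrite gee0_abs ?lee_fin//.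
  by rewrite integral_indic// setIT BE ltry.
by rewrite /Rintegral integral_indic// setIT -mulrA mulVf ?mulr1// gt_eqF.
Qed.

Lemma L2dot_average_close (h : T -> R) (c e : R) : 0 <= e -> sq_integrable mu h ->
  {ae mu, forall z, B z -> `|h z - c| <= e} ->
  `|L2dot mu h (average B) - c| <= e.
Proof.
move=> e_ge0 sh hc.
have sc (k : R) : sq_integrable mu (fun=> k).
  by apply: (@sq_integrable_bounded _ `|k|).
have sa := sq_integrable_average.
have shc := sq_integrableB sh (sc c).
have i1 := sq_integrableM shc sa.
have i2 := sq_integrableM (sc e) sa.
rewrite -[X in _ - X](L2dot_cst_average c) -(L2dotBl sh (sc c) sa).
apply: le_trans (le_normr_Rintegral _ i1) _ => //.
rewrite -[leRHS](L2dot_cst_average e) /L2dot /Rintegral.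
apply: fine_le.
- exact: integrable_fin_num (integrable_norm i1).
- exact: integrable_fin_num.
apply: ae_ge0_le_integral => //.
- have /measurable_EFinP m1 := measurable_int _ i1.
  by apply/measurable_EFinP; exact: measurableT_comp m1.
- by move=> x _; rewrite lee_fin mulr_ge0 ?average_ge0// e_ge0.
- exact: measurable_int i2.
apply: filterS hc => z hz _; rewrite lee_fin normrM (ger0_norm (average_ge0 z)).
rewrite /average indicE; have [zB|zB] := boolP (z \in B).
  by rewrite ler_wpM2r ?mulr_ge0 ?invr_ge0 ?(ltW fB0)// hz//; exact: set_mem.
by rewrite !mulr0.
Qed.

End averages.

Section ae_support.
Import finmap.

(** For each n, compactness covers D by finitely many balls of radius 1 / (n + 1). The null ones
    among them, over all n, form a null set, and a point of D outside it lies in arbitrarily small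
    covering balls of positive measure. *)
Lemma ae_support (R : realType) d (D : set (eucl R d))
    (m : {measure set (eucl R d) -> \bar R}) : compact D ->
  {ae m, forall x, D x -> forall e : R, 0 < e -> (0 < m (ball x e))%E}.
Proof.
rewrite compact_cover => cD.
have mball (x : eucl R d) (r : R) : measurable (ball x r).
  by apply: eucl_open_measurable; exact: ball_open.
have /choice[C HC] : forall n : nat, exists C : {fset eucl R d},
    D `<=` \bigcup_(c in [set` C]) ball c (n.+1%:R^-1).
  move=> n; have [] := cD _ setT (fun c => ball c (n.+1%:R^-1 : R)).
  - by move=> c _; apply: ball_open.
  - by move=> x Dx; exists x => //; exact: ballxx.
  - by move=> C _ DC; exists C.
pose F n (c : eucl R d) : set (eucl R d) :=
  if m (ball c n.+1%:R^-1) == 0%E then ball c n.+1%:R^-1 else set0.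
apply: (@negligibleS _ _ _ _ (\bigcup_n \bigcup_(c in [set` C n]) F n c)).
  move=> x /=; apply: contra_notP => xN Dx e e0.
  have e20 : 0 < e / 2 by rewrite divr_gt0.
  have [k _ /(_ k (leqnn _))/= ke] := near_infty_natSinv_lt (PosNum e20).
  have [c cC cx] := HC k x Dx.
  have cm : m (ball c k.+1%:R^-1) != 0%E.
    apply: contra_notN xN => cm; exists k => //; exists c => //.
    by rewrite /F cm.
  apply: (@lt_le_trans _ _ (m (ball c k.+1%:R^-1))); first by rewrite lt0e cm/=.
  apply: le_measure; [exact: mem_set|exact: mem_set|].
  move=> z cz; rewrite [e]splitr; apply: (@ball_triangle _ _ c).
    by apply: ball_sym; exact: le_ball (ltW ke) _ cx.
  exact: le_ball (ltW ke) _ cz.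
apply: negligible_bigcup => n.
rewrite bigcup_seq.
elim/big_ind : _ => [|A B nA nB|c _]; first exact: negligible_set0.
  exact: negligibleU.
rewrite /F; case: ifPn => [/eqP m0|_]; last exact: negligible_set0.
by exists (ball c n.+1%:R^-1); split.
Qed.

End ae_support.

(** * Point evaluation of a random function *)

Section fatou_bound.
Local Open Scope ereal_scope.
Context d (T : measurableType d) (R : realType) (mu : {measure set T -> \bar R}).
Variables (f : nat -> T -> \bar R) (C : \bar R).
Hypotheses (mf : forall n, measurable_fun setT (f n)) (f0 : forall n x, 0 <= f n x).
Hypothesis fC : forall n, \int[mu]_x f n x <= C.

Lemma fatou_bound : \int[mu]_x limn_einf (f^~ x) <= C.
Proof.
apply: le_trans (fatou _ _ _ _) _ => //.
rewrite limn_einf_lim; apply: lime_le; first exact: is_cvg_einfs.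
apply: nearW => n; apply: le_trans (fC n); apply: ereal_inf_lbound.
by exists n => //=.
Qed.

Lemma fatou_bound_cvg (g : T -> \bar R) :
  (forall x, (fun n => f n x) @ \oo --> g x) ->
  measurable_fun setT g /\ \int[mu]_x g x <= C.
Proof.
move=> fg; split.
  by apply: (emeasurable_fun_cvg f) => // x _; exact: fg.
rewrite (_ : g = fun x => limn_einf (f^~ x)); first exact: fatou_bound.
apply/funext => x; rewrite is_cvg_limn_einfE.
  by apply/esym/cvg_lim => //; exact: fg.
by apply/cvg_ex; exists (g x); exact: fg.
Qed.

End fatou_bound.

Section encoding_analysis.
Context (R : realType) (d : nat) (D : set (eucl R d)) (cD : compact D).
Local Notation nu := (lebesgue_on cD).
Hypothesis nu_fin : (nu setT < +oo)%E.

Lemma ae_lebesgue_on : {ae nu, forall x, D x}.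
Proof.
exists (~` D); split => //.
  by apply: measurableC; exact: eucl_compact_measurable.
rewrite [LHS](_ : _ = lebesgue_eucl R d (~` D `&` D))// setIC setICr.
exact: measure0.
Qed.

Lemma sq_integrable_L2fun (u : L2 nu) : sq_integrable nu u.
Proof.
by apply: L2norm_lt_sq_integrable; [exact: measurable_L2fun|exact: L2norm_lty].
Qed.

Lemma pevalP (u : L2 nu) : continuous_version u !=set0 ->
  {within D, continuous (peval u)} /\ peval u = L2fun u %[ae nu].
Proof. by move=> [g gu]; exact: (xgetPex (cst 0) (ex_intro _ g gu)). Qed.

(** At such points all continuous versions of a class agree, since the value is the limit of
    averages over balls. *)
Definition support_point x := D x /\ forall e : R, 0 < e -> (0 < nu (ball x e))%E.

Definition ball_average x k := average nu (ball x (k.+1%:R^-1 : R)).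

Let mball (x : eucl R d) (r : R) : measurable (ball x r).
Proof. by apply: eucl_open_measurable; exact: ball_open. Qed.

Lemma sq_integrable_ball_average x k : support_point x ->
  sq_integrable nu (ball_average x k).
Proof. by move=> [_ x0]; apply: sq_integrable_average => //; exact: x0. Qed.

Lemma cvg_ball_average x (u : L2 nu) : support_point x ->
  continuous_version u !=set0 ->
  (fun k => L2dot nu u (ball_average x k)) @ \oo --> peval u x.
Proof.
move=> [Dx x0] /pevalP[cu uE].
apply/cvgrPdist_le => e e0.
have /subspace_continuousP/(_ x Dx) := cu.
move=> /cvgrPdist_le/(_ _ e0).
rewrite /within/= -nbhs_ballE => -[r /= r0 hr].
near=> k; rewrite distrC.
apply: L2dot_average_close => //; first exact: x0.
- exact: ltW.
- exact: sq_integrable_L2fun.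
have kr : k.+1%:R^-1 < r by near: k; exact: (near_infty_natSinv_lt (PosNum r0)).
near=> z => Bz.
have <- : peval u z = u z by near: z; move: uE; apply: filterS => z /(_ I).
rewrite distrC; apply: hr; first exact: le_ball (ltW kr) _ Bz.
by near: z; exact: ae_lebesgue_on.
Unshelve. all: by end_near. Qed.

Lemma L2dot_average_bound (u : eucl R d -> R) b x k : 0 <= b ->
  support_point x -> sq_integrable nu u -> {ae nu, forall z, `|u z| <= b} ->
  `|L2dot nu u (ball_average x k)| <= b.
Proof.
move=> b0 [Dx x0] su ub; rewrite -[L2dot _ _ _]subr0.
apply: L2dot_average_close => //; first exact: x0.
by apply: filterS ub => z; rewrite subr0.
Qed.

Variables (mu : probability (L2 nu) R) (Gamma : L2 nu -> L2 nu).
Variables (lam : nat -> R) (phi : nat -> L2 nu).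
Hypothesis covGamma : uncentered_covariance mu Gamma.
Hypothesis eigen : eigensystem Gamma lam phi.

Definition coef (u : L2 nu) i := L2dot nu u (phi i).

(** The weak integral defining Gamma (phi i), tested against phi j, is the mixed second moment; the
    eigenvalue equation evaluates it. *)
Lemma covariance_coef i j :
  mu.-integrable setT (fun u => (coef u i * coef u j)%:E) /\
  (\int[mu]_u (coef u i * coef u j)%:E)%E = (lam i *+ (i == j))%:E.
Proof.
have tE (u : L2 nu) : L2dot nu (tensor u u (phi i)) (phi j) = coef u i * coef u j.
  by rewrite /tensor L2dotZl//; exact: sq_integrable_L2fun.
have [im Em] := covGamma (phi i) (phi j).
have fE : (fun u : L2 nu => (L2dot nu (tensor u u (phi i)) (phi j))%:E) =
    (fun u => (coef u i * coef u j)%:E) by apply/funext => u; rewrite tE.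
rewrite fE in im; split => //.
rewrite -[LHS]fineK; last exact: integrable_fin_num im.
congr EFin; transitivity (L2dot nu (Gamma (phi i)) (phi j)).
  by rewrite Em /Rintegral; congr fine; apply: eq_integral => u _; rewrite tE.
have [_ [ortho _] phiE] := eigen.
rewrite -mulr_natr -ortho -L2dotZl; [|exact: sq_integrable_L2fun..].
rewrite /L2dot /Rintegral; congr fine.
have mG := measurable_L2fun (Gamma (phi i)).
have mp k := measurable_L2fun (phi k).
apply: ae_eq_integral => //.
- by apply/measurable_EFinP; exact: measurable_funM.
- apply/measurable_EFinP; apply: measurable_funM => //.
  exact: measurable_funM.
by apply: filterS (phiE i) => x /(_ I) xE _; rewrite xE.
Qed.

Lemma eigenvalue_ge0 i : 0 <= lam i.
Proof.
have [_ ] := covariance_coef i i; rewrite eqxx mulr1n => lamE.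
rewrite -lee_fin -lamE; apply: integral_ge0 => u _.
by rewrite lee_fin -expr2 sqr_ge0.
Qed.

Local Notation tail m := (\sum_(m <= l <oo) (lam l)%:E)%E.

(** r u is the series of coef u l times the pairing of phi l with w, over l >= m. The coefficients
    are orthogonal under mu with second moments lam l, which bounds its partial sums; Fatou's lemma
    passes to the limit. *)
Lemma expectation_remainder_pairing (w : eucl R d -> R) (b : R) m : 0 <= b ->
  sq_integrable nu w -> (forall i, `|L2dot nu (phi i) w| <= b) ->
  let r (u : L2 nu) := L2dot nu u w - \sum_(i < m) coef u i * L2dot nu (phi i) w in
  measurable_fun setT (fun u => (r u ^+ 2)%:E) /\
  (\int[mu]_u (r u ^+ 2)%:E <= (b ^+ 2)%:E * tail m)%E.
Proof.
move=> b0 sw wb r; pose a i := L2dot nu (phi i) w.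
have fE n := integral_sqr_orthogonal a
  (fun i j => (covariance_coef i j).1) (fun i j => (covariance_coef i j).2)
  (iota_uniq m (n - m)).
apply: (@fatou_bound_cvg _ _ _ mu
  (fun n u => ((\sum_(m <= i < n) a i * coef u i) ^+ 2)%:E)).
- by move=> n; exact: measurable_int (fE n).1.
- by move=> n u; rewrite lee_fin sqr_ge0.
- move=> n; rewrite (fE n).2.
  apply: (@le_trans _ _ ((b ^+ 2)%:E * (\sum_(m <= i < n) (lam i)%:E))%E).
    rewrite sumEFin -EFinM lee_fin mulr_sumr; apply: ler_sum => i _.
    rewrite ler_wpM2r ?eigenvalue_ge0// -(real_normK (num_real (a i))).
    by rewrite ler_pXn2r ?nnegrE// wb.
  rewrite lee_wpmul2l ?lee_fin ?sqr_ge0//; apply: nneseries_lim_ge => i _ _.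
  by rewrite lee_fin eigenvalue_ge0.
move=> u; apply: cvg_EFin; first exact: nearW.
rewrite expr2; under eq_fun do rewrite expr2.
have rcvg : (fun n => \sum_(m <= i < n) a i * coef u i) @ \oo --> r u.
  have [_ [_ basis] _] := eigen.
  have := @L2dot_expansion _ _ _ _ _ _ (coef u) (sq_integrable_L2fun u)
    (fun i => sq_integrable_L2fun (phi i)) (basis u) w sw.
  move=> /cvgB/(_ (cvg_cst (\sum_(i < m) coef u i * L2dot nu (phi i) w))).
  apply: cvg_trans; apply: near_eq_cvg; near=> n.
  have mn : (m <= n)%N by near: n; exact: nbhs_infty_ge.
  transitivity (\sum_(0 <= i < n) coef u i * L2dot nu (phi i) w -
    \sum_(i < m) coef u i * L2dot nu (phi i) w); first by rewrite big_mkord.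
  rewrite (@big_cat_nat _ _ _ m)//= big_mkord addrAC subrr add0r.
  by apply: eq_bigr => i _; rewrite mulrC.
by apply: cvgM; exact: rcvg.
Unshelve. all: by end_near. Qed.

End encoding_analysis.

Section ae_le_integral.
Import HBNNSimple.
Local Open Scope ereal_scope.
Context d (T : measurableType d) (R : realType) (mu : {measure set T -> \bar R}).

(* [f] need not be measurable: the integral of a nonnegative function is the supremum
   of the integrals of the simple functions below it. This is needed because [peval]
   involves a choice on the null set of classes without continuous version. *)
Lemma ae_le_integral (f g : T -> \bar R) : (forall x, 0 <= f x) ->
  measurable_fun setT g -> (forall x, 0 <= g x) ->
  {ae mu, forall x, f x <= g x} -> \int[mu]_x f x <= \int[mu]_x g x.
Proof.
move=> f0 mg g0 [N [mN N0 fgN]].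
(* Infinite on the exceptional set, this dominates f everywhere and has the same integral as g. *)
pose g' x := g x + +oo * (\1_N x)%:E.
have mg' : measurable_fun setT g'.
  apply: emeasurable_funD => //; apply: measurable_funeM.
  by apply/measurable_EFinP; exact: measurable_indic.
have g'0 x : 0 <= g' x by rewrite adde_ge0// mule_ge0.
have <- : \int[mu]_x g' x = \int[mu]_x g x.
  apply: ae_eq_integral => //; exists N; split => // x /=.
  apply: contra_notP => xN _; by rewrite /g' indicE memNset// mule0 adde0.
have fg' x : f x <= g' x.
  rewrite /g'; have [xN|xN] := pselect (N x).
    by rewrite indicE mem_set// mule1 addey ?leey// gt_eqF// (lt_le_trans _ (g0 x)).
  rewrite indicE memNset// mule0 adde0.
  by apply: contrapT => h; apply: xN; exact: fgN.
rewrite ge0_integralTE// ge0_integralTE//; apply: ereal_sup_le => _ [h hf <-].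
exists h => // x.
exact: le_trans (hf x) (fg' x).
Qed.
End ae_le_integral.

(** * The encoding error for fixed sensors *)

Section encoding_bound.
Context (R : realType) (d : nat) (D : set (eucl R d)) (cD : compact D).
Local Notation nu := (lebesgue_on cD).
Hypothesis nu_fin : (nu setT < +oo)%E.
Variables (mu : probability (L2 nu) R) (Gamma : L2 nu -> L2 nu).
Variables (lam : nat -> R) (phi : nat -> L2 nu) (b : R).
Hypothesis covGamma : uncentered_covariance mu Gamma.
Hypothesis eigen : eigensystem Gamma lam phi.
Hypothesis muC : {ae mu, forall u, continuous_version u !=set0}.
Hypothesis phiC : forall l, continuous_version (phi l) !=set0.
Hypotheses (b0 : 0 <= b) (phi_b : forall l, {ae nu, forall z, `|phi l z| <= b}).

Local Notation tail m := (\sum_(m <= l <oo) (lam l)%:E)%E.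

Let remainder m (u : L2 nu) x :=
  peval u x - \sum_(i < m) coef phi u i * peval (phi i) x.

(* No joint measurability of evaluation is needed: at a support point the value is the
   limit of averages over shrinking balls, which are continuous linear functionals,
   and Fatou's lemma passes the bound for averages to the limit. *)
Lemma expectation_remainder_eval x m : support_point cD x ->
  exists H : L2 nu -> \bar R, [/\ measurable_fun setT H, (forall u, 0 <= H u)%E,
    (\int[mu]_u H u <= (b ^+ 2)%:E * tail m)%E &
    forall u, continuous_version u !=set0 -> H u = (remainder m u x ^+ 2)%:E].
Proof.
move=> sx; pose w := ball_average cD x.
have sw k : sq_integrable nu (w k) by exact: sq_integrable_ball_average.
have wb k i : `|L2dot nu (phi i) (w k)| <= b.
  by apply: L2dot_average_bound => //; exact: sq_integrable_L2fun.
pose r k (u : L2 nu) := L2dot nu u (w k) -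
  \sum_(i < m) coef phi u i * L2dot nu (phi i) (w k).
pose f k u := (r k u ^+ 2)%:E.
have fk k := expectation_remainder_pairing covGamma eigen m b0 (sw k) (wb k).
have mf k : measurable_fun setT (f k) by exact: (fk k).1.
have f0 k u : (0 <= f k u)%E by rewrite lee_fin sqr_ge0.
(* The lower limit is defined and measurable at every u, also where there is no continuous version
   and the averages may diverge. *)
exists (fun u => limn_einf (f^~ u)); split.
- apply: (emeasurable_fun_cvg (fun n u => einfs (f^~ u) n)).
    by move=> n; exact: measurable_fun_einfs.
  by move=> u _; rewrite limn_einf_lim; exact: is_cvg_einfs.
- move=> u; rewrite limn_einf_lim; apply: lime_ge; first exact: is_cvg_einfs.
  by apply: nearW => n; apply: le_ereal_inf_tmp => _ [k _ <-].
- by apply: fatou_bound => // k; exact: (fk k).2.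
move=> u uC.
have rcvg : (fun k => r k u) @ \oo --> remainder m u x.
  apply: cvgB; first exact: cvg_ball_average.
  apply: cvg_big => [|i _]; first exact: add_continuous.
  by apply: cvgMl_tmp; exact: cvg_ball_average.
have fcvg : f^~ u @ \oo --> (remainder m u x ^+ 2)%:E.
  apply: cvg_EFin; first exact: nearW.
  rewrite expr2 /f /=; under eq_fun do rewrite expr2.
  by apply: cvgM; exact: rcvg.
rewrite is_cvg_limn_einfE; first by apply/cvg_lim => //; exact: fcvg.
by apply/cvg_ex; eexists; exact: fcvg.
Qed.

Lemma expectation_coef_tail m :
  measurable_fun setT (fun u => \sum_(m <= l <oo) (coef phi u l ^+ 2)%:E)%E /\
  (\int[mu]_u \sum_(m <= l <oo) (coef phi u l ^+ 2)%:E = tail m)%E.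
Proof.
have cf l := covariance_coef covGamma eigen l l.
have mc l : measurable_fun setT (fun u => (coef phi u l ^+ 2)%:E).
  by under eq_fun do rewrite expr2; exact: measurable_int (cf l).1.
have c0 l u : (0 <= (coef phi u l ^+ 2)%:E)%E by rewrite lee_fin sqr_ge0.
split.
  have -> : (fun u => \sum_(m <= l <oo) (coef phi u l ^+ 2)%:E)%E =
      (fun u => \sum_(0 <= l <oo) (coef phi u (l + m)%N ^+ 2)%:E)%E.
    by apply/funext => u; rewrite (nneseries_addn m (fun i => c0 i u)).
  by apply: ge0_emeasurable_sum => // l; exact: mc.
transitivity (\int[mu]_u \sum_(0 <= l <oo) (coef phi u (l + m)%N ^+ 2)%:E)%E.
  by apply: eq_integral => u _; rewrite (nneseries_addn m (fun i => c0 i u)).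
rewrite integral_nneseries//.
rewrite -nneseries_addn => [|l]; last by rewrite lee_fin (eigenvalue_ge0 covGamma eigen).
apply: eq_eseriesr => l _; under eq_integral do rewrite expr2.
by rewrite (cf _).2 eqxx mulr1n.
Qed.

(** The samples of u are those of the remainder plus S^T c, with c the first m coefficients, and the
    decoding matrix is a left inverse of S^T. *)
Lemma decode_remainder m M (x : 'I_M -> eucl R d) (u : L2 nu) t :
  gram phi m x \in unitmx ->
  let e := invmx (gram phi m x) *m sampling_matrix phi m x *m
           (\col_j remainder m u (x j)) in
  decoder phi m x (encoder x u) t - u t =
  \sum_(k < m) e k 0 * phi k t + (\sum_(k < m) coef phi u k * phi k t - u t).
Proof.
move=> uG e; rewrite addrA; congr (_ - _); rewrite -big_split/=.
apply: eq_bigr => k _; rewrite -mulr_suml -mulrDl; congr (_ * _).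
pose S := sampling_matrix phi m x; pose c : 'cV[R]_m := \col_k coef phi u k.
have encE : (encoder x u)^T = \col_j remainder m u (x j) + S^T *m c.
  apply/matrixP => j j'; rewrite !mxE /remainder.
  rewrite [X in _ = _ - _ + X](eq_bigr
    (fun i : 'I_m => coef phi u i * peval (phi i) (x j))).
    by rewrite subrK.
  by move=> i _; rewrite !mxE mulrC.
transitivity ((pinv_sampling phi m x *m (encoder x u)^T) k 0).
  by rewrite mxE; apply: eq_bigr => j _; rewrite [(_^T) _ _]mxE.
rewrite encE mulmxDr mxE; congr (_ + _).
have -> : pinv_sampling phi m x *m (S^T *m c) = c.
  by rewrite /pinv_sampling -/S mulmxA -(mulmxA _ S) mulVmx// mul1mx.
by rewrite mxE.
Qed.

(** In the constant, 2 / th comes from (f + g)^2 <= 2 f^2 + 2 g^2 and from the least squares bound,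
    M b^2 from M sensors each contributing b^2 times the tail, and 4 from the same splitting
    together with [integral_sqr_remainder_le]. *)
Lemma encoding_error_le m M (x : 'I_M -> eucl R d) (th : R) : 0 < th ->
  (forall j, support_point cD (x j)) ->
  (forall a, th * mxform 1%:M a a <= mxform (gram phi m x) a a) ->
  gram phi m x \in unitmx /\
  (encoding_error mu phi m x <=
    sqrte ((2 / th * M%:R * b ^+ 2 + 4)%:E * tail m))%E.
Proof.
move=> th0 sx thG.
have [uG _] := mxform_solve_le (0 : 'cV_M) th0 thG; split=> //.
have /choice[H HP] := fun j => expectation_remainder_eval m (sx j).
have [mK EK] := expectation_coef_tail m.
set K := (fun u => (\sum_(m <= l <oo) _)%E) in mK EK.
have K0 u : (0 <= K u)%E.
  by apply: nneseries_ge0 => l _ _; rewrite lee_fin sqr_ge0.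
have T0 : (0 <= tail m)%E.
  by apply: nneseries_ge0 => l _ _; rewrite lee_fin (eigenvalue_ge0 covGamma eigen).
have th20 : 0 <= 2 / th by rewrite divr_ge0// ltW.
pose HH u := (\sum_j H j u)%E.
have HH0 u : (0 <= HH u)%E by apply: sume_ge0 => j _; have [_ + _ _] := HP j.
have mHH : measurable_fun setT HH.
  by apply: emeasurable_sum => j; have [+ _ _ _] := HP j.
have EHH : (\int[mu]_u HH u <= (M%:R * b ^+ 2)%:E * tail m)%E.
  rewrite ge0_integral_sum//; last 2 first.
  - by move=> j; have [+ _ _ _] := HP j.
  - by move=> j u _; have [_ + _ _] := HP j.
  apply: (@le_trans _ _ (\sum_(j < M) (b ^+ 2)%:E * tail m)%E).
    by apply: lee_sum => j _; have [_ _ + _] := HP j.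
  rewrite -ge0_sume_distrl => [|j _]; last by rewrite lee_fin sqr_ge0.
  by rewrite sumEFin sumr_const card_ord mulr_natl.
rewrite /encoding_error lee_sqrt; last first.
  by rewrite mule_ge0// lee_fin addr_ge0// mulr_ge0 ?sqr_ge0// mulr_ge0.
apply: (@le_trans _ _ (\int[mu]_u ((2 / th)%:E * HH u + 4%:E * K u))%E).
  apply: ae_le_integral.
  - by move=> u; rewrite expe_ge0// Lnorm_ge0.
  - by apply: emeasurable_funD; exact: measurable_funeM.
  - by move=> u; rewrite adde_ge0// mule_ge0.
  apply: filterS muC => u uC; rewrite L2norm_sqr.
  under eq_integral do rewrite decode_remainder//.
  set e := _ *m _ *m _.
  have [_ [ortho basis] _] := eigen.
  have sphi (k : 'I_m) := sq_integrable_L2fun (phi k).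
  have [m1 _] : sq_integrable nu (fun t => \sum_(k < m) e k 0 * phi k t).
    by apply: sq_integrable_sum => k; exact: sq_integrableZ.
  have [m2 _] : sq_integrable nu (fun t => \sum_(k < m) coef phi u k * phi k t - u t).
    apply: sq_integrableB; last exact: sq_integrable_L2fun.
    by apply: sq_integrable_sum => k; exact: sq_integrableZ.
  apply: le_trans (integral_sqrD_le nu m1 m2) _; apply: leeD.
    have := @integral_sqr_orthonormal _ _ _ nu (fun k => L2fun (phi k))
      (fun k => sq_integrable_L2fun (phi k)) ortho 'I_m (index_enum 'I_m)
      (@nat_of_ord m) (fun k => e k 0) (@ord_inj m) (index_enum_uniq _).
    move=> ->; rewrite [HH u](_ : _ = (\sum_j remainder m u (x j) ^+ 2)%:E); last first.
      by rewrite -sumEFin; apply: eq_bigr => j _; have [_ _ _ ->] := HP j.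
    rewrite -!EFinM lee_fin -mulrA ler_wpM2l// mulrC ler_pdivlMr// mulrC.
    have [_] := mxform_solve_le (\col_j remainder m u (x j)) th0 thG.
    rewrite -/e mxform1E => /le_trans; apply.
    by rewrite mxE; apply: ler_sum => j _; rewrite !mxE expr2.
  rewrite (_ : 4%:E = 2%:E * 2%:E)%E; last by rewrite -EFinM -natrM.
  rewrite -muleA lee_wpmul2l//.
  under eq_integral do rewrite -sqrrN opprB.
  exact: (integral_sqr_remainder_le (sq_integrable_L2fun u)
    (fun k => sq_integrable_L2fun (phi k)) (basis u) ortho).
rewrite ge0_integralD//; last 4 first.
- by move=> u _; rewrite mule_ge0.
- exact: measurable_funeM.
- by move=> u _; rewrite mule_ge0.
- exact: measurable_funeM.
rewrite !ge0_integralZl// EK.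
have A0 : 0 <= 2 / th * M%:R * b ^+ 2 by rewrite mulr_ge0 ?sqr_ge0// mulr_ge0.
rewrite [in leRHS]EFinD [leRHS]ge0_muleDl ?lee_fin// leeD2r//.
by rewrite -mulrA [in leRHS]EFinM -muleA lee_wpmul2l.
Qed.

End encoding_bound.

(** * Random sensors *)

Lemma integral_mscale d (T : measurableType d) (R : realType)
    (k : {nonneg R}) (m : {measure set T -> \bar R}) (f : T -> \bar R) :
  m.-integrable setT f ->
  (\int[mscale k m]_x f x = k%:num%:E * \int[m]_x f x)%E.
Proof.
move=> intf; have mf := measurable_int _ intf.
rewrite [LHS]integralE [X in (_ * X)%E]integralE.
rewrite ge0_integral_mscale//; last exact: measurable_funepos.
rewrite ge0_integral_mscale//; last exact: measurable_funeneg.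
by rewrite -muleBr//; exact: integrable_add_def.
Qed.

Section uniform.
Context (R : realType) (d : nat) (D : set (eucl R d)) (cD : compact D).
Context dO (Om : measurableType dO) (P : probability Om R).
Variable X : {RV P >-> eucl R d}.
Hypothesis unifX : uniform_on D X.
Hypothesis D0 : (0 < lebesgue_eucl R d D)%E.
Local Notation v := (fine (lebesgue_eucl R d D)).

(** With D of infinite measure the quotient would give the whole space probability 0. *)
Lemma uniform_on_finite : (lebesgue_eucl R d D < +oo)%E.
Proof.
rewrite ltey; apply/eqP => Doo; have := unifX measurableT.
rewrite setTI Doo [LHS](probability_setT (distribution P X)) invey mule0 => /eqP.
by rewrite eqe oner_eq0.
Qed.

Let vE : lebesgue_eucl R d D = v%:E.
Proof. by rewrite fineK// ge0_fin_numE ?uniform_on_finite// ltW. Qed.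

Let v0 : 0 < v.
Proof. by rewrite -lte_fin -vE. Qed.

Lemma integral_uniform (f : eucl R d -> R) :
  (lebesgue_on cD).-integrable setT (EFin \o f) ->
  (\int[distribution P X]_x (f x)%:E =
    v^-1%:E * \int[lebesgue_on cD]_x (f x)%:E)%E.
Proof.
move=> intf; have vi0 : 0 <= v^-1 by rewrite invr_ge0 ltW.
rewrite -[in RHS](integral_mscale (NngNum vi0) intf).
apply: eq_measure_integral => A mA _.
rewrite [RHS](_ : _ = v^-1%:E * lebesgue_eucl R d (A `&` D))%E// muleC.
by rewrite [LHS](unifX mA) [in LHS]vE inver gt_eqF.
Qed.

Lemma ae_uniform (Q : eucl R d -> Prop) :
  {ae lebesgue_on cD, forall x, Q x} -> {ae P, forall w, Q (X w)}.
Proof.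
move=> [N [mN N0 QN]]; exists (X @^-1` N); split.
- by rewrite -[X in measurable X]setTI; exact: measurable_funPT.
- have := unifX mN; rewrite /distribution /pushforward => ->.
  by rewrite [X in (X / _)%E](_ : _ = 0%E)// mul0e.
- by move=> w /= Qw; apply: QN.
Qed.

End uniform.

(** * Eigenfunctions at uniform sensors *)

Section sampled_basis.
Context (R : realType) (d : nat) (D : set (eucl R d)) (cD : compact D).
Local Notation nu := (lebesgue_on cD).
Local Notation v := (fine (lebesgue_eucl R d D)).
Hypothesis D0 : (0 < lebesgue_eucl R d D)%E.
Variables (phi : nat -> L2 nu).
Hypothesis phi_orthonormal : forall i j, L2dot nu (phi i) (phi j) = (i == j)%:R.
Hypothesis phiC : forall l, continuous_version (phi l) !=set0.
Hypothesis phi_bdd : (sup_Linfty phi < +oo)%E.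
Local Notation b := (fine (sup_Linfty phi)).

Lemma lebesgue_on_setT : nu setT = lebesgue_eucl R d D.
Proof.
by rewrite [LHS](_ : _ = lebesgue_eucl R d (setT `&` D))// setTI.
Qed.

Let norm_phi_le l : ('N[nu]_+oo[EFin \o L2fun (phi l)] <= sup_Linfty phi)%E.
Proof. by apply: ereal_sup_ubound; exists l. Qed.

Lemma sup_Linfty_ge0 : 0 <= b.
Proof. by rewrite fine_ge0// (le_trans _ (norm_phi_le 0))// Lnorm_ge0. Qed.

Lemma ae_sup_Linfty l : {ae nu, forall z, `|phi l z| <= b}.
Proof.
have := norm_phi_le l; rewrite unlock /= lebesgue_on_setT D0 => /ess_supP.
apply: filterS => z /=; rewrite -lee_fin fineK// ge0_fin_numE//.
by rewrite (le_trans _ (norm_phi_le 0))// Lnorm_ge0.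
Qed.

(* An everywhere bounded, measurable representative of the continuous version. *)
Definition clipped_basis (k : nat) (z : eucl R d) : R :=
  Num.max (- b) (Num.min b (phi k z)).

Lemma measurable_clipped_basis k : measurable_fun setT (clipped_basis k).
Proof.
apply: measurable_maxr => //; apply: measurable_minr => //.
exact: measurable_L2fun.
Qed.

Lemma clipped_basis_le k z : `|clipped_basis k z| <= b.
Proof.
have := sup_Linfty_ge0; rewrite /clipped_basis ler_norml => bb.
rewrite le_max lexx/= ge_max ge_min lexx/= andbT.
by rewrite (le_trans _ bb)// oppr_le0.
Qed.

Lemma ae_clipped_basis k : {ae nu, forall z, clipped_basis k z = phi k z}.
Proof.
apply: filterS (ae_sup_Linfty k) => z; rewrite ler_norml => /andP[lo up].
by rewrite /clipped_basis (min_idPr up) (max_idPr lo).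
Qed.

Lemma ae_clipped_eval :
  {ae nu, forall z, support_point cD z /\ forall k, clipped_basis k z = peval (phi k) z}.
Proof.
have h1 : {ae nu, forall z, support_point cD z}.
  apply: filterS2 (ae_lebesgue_on cD) (ae_support nu cD) => z Dz h.
  by split=> // e; exact: h.
have h2 : {ae nu, forall z, forall k, clipped_basis k z = peval (phi k) z}.
  apply: ae_foralln => k.
  have [_ pE] := pevalP (phiC k).
  by apply: filterS2 (ae_clipped_basis k) pE => z -> /(_ I) ->.
by apply: filterS2 h1 h2.
Qed.

(** The factor sqrt |D| compensates the density 1 / |D| of the uniform law, so that the sampled
    vectors are isotropic. *)
Lemma integral_clipped_basis dO (Om : measurableType dO) (P : probability Om R)
    (X : {RV P >-> eucl R d}) k l : uniform_on D X ->
  (\int[distribution P X]_z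
    ((Num.sqrt v * clipped_basis k z) * (Num.sqrt v * clipped_basis l z))%:E)%E =
  (k == l)%:R%:E.
Proof.
move=> uX; have Dfin := uniform_on_finite uX.
have vE : lebesgue_eucl R d D = v%:E by rewrite fineK// ge0_fin_numE// ltW.
have v0 : 0 < v by rewrite -lte_fin -vE.
have sv : Num.sqrt v * Num.sqrt v = v by rewrite -expr2 sqr_sqrtr// ltW.
have nu_fin : (nu setT < +oo)%E by rewrite lebesgue_on_setT.
have sc j : sq_integrable nu (clipped_basis j).
  exact: (sq_integrable_bounded nu_fin (measurable_clipped_basis j) (clipped_basis_le j)).
have ic := sq_integrableM (sc k) (sc l).
have iz : nu.-integrable setT
  (fun z => ((Num.sqrt v * clipped_basis k z) * (Num.sqrt v * clipped_basis l z))%:E).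
  by apply: sq_integrableM; exact: sq_integrableZ.
rewrite (integral_uniform uX D0 iz).
under eq_integral do rewrite mulrACA sv EFinM.
rewrite integralZl// muleA -EFinM (mulVf (lt0r_neq0 v0)) mul1e.
rewrite -phi_orthonormal /L2dot /Rintegral fineK; last first.
  by apply: integrable_fin_num => //; apply: sq_integrableM; exact: sq_integrable_L2fun.
have mc := measurable_clipped_basis.
have mp j := measurable_L2fun (phi j).
apply: ae_eq_integral => //.
- by apply/measurable_EFinP; exact: measurable_funM.
- by apply/measurable_EFinP; exact: measurable_funM.
by apply: filterS2 (ae_clipped_basis k) (ae_clipped_basis l) => z -> ->.
Qed.

End sampled_basis.

(** * The almost sure bound with random sensors *)

Theorem theorem3p9 (R : realType) :
  exists C : R -> R -> R, (forall b v, 1 <= C b v) /\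
  forall (d : nat) (D : set (eucl R d)) (cD : compact D)
    (D0 : (0 < lebesgue_eucl R d D)%E)
    (mu : probability (L2 (lebesgue_on cD)) R)
    (mu2 : (\int[mu]_u (L2norm (lebesgue_on cD) u) ^+ 2 < +oo)%E)
    (muC : {ae mu, forall u, continuous_version u !=set0})
    (Gamma : L2 (lebesgue_on cD) -> L2 (lebesgue_on cD))
    (covGamma : uncentered_covariance mu Gamma)
    (lam : nat -> R) (phi : nat -> L2 (lebesgue_on cD))
    (eigen : eigensystem Gamma lam phi)
    (phiC : forall l, continuous_version (phi l) !=set0)
    (phi_bdd : (sup_Linfty phi < +oo)%E)
    (dO : measure_display) (Omega : measurableType dO)
    (P : probability Omega R) (X : nat -> {RV P >-> eucl R d})
    (indepX : mutually_independent X)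
    (unifX : forall n, uniform_on D (X n)),
  let c := C (fine (sup_Linfty phi)) (fine (lebesgue_eucl R d D)) in
  {ae P, forall w, \forall M \near \oo,
     exists m : nat, [/\ (0 < m <= M)%N,
       gram phi m (fun j : 'I_M => X j w) \in unitmx &
       (encoding_error mu phi m (fun j : 'I_M => X j w) <=
        c%:E * sqrte (\sum_(0 <= l <oo | (M%:R / (c * ln M%:R) < l.+1%:R)%R)
                        (lam l)%:E))%E]}.
Proof.
(* The term with 400 meets the sampling bound, where squares of the functions are at most v b^2. The
   summand 4 gives c >= 4 and covers the 4 of the error bound; the absolute value keeps C >= 1 at
   all real arguments. *)
exists (fun b v => 4 + 400 * `|v| * b ^+ 2); split=> [b v|].
  apply: (@le_trans _ _ 4); first by rewrite ler1n.
  rewrite lerDl; apply: mulr_ge0; last exact: sqr_ge0.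
  by apply: mulr_ge0; [exact: ler0n|exact: normr_ge0].
move=> d D cD D0 mu _ muC Gamma covGamma lam phi eigen phiC phi_bdd dO Omega P X
  indepX unifX c.
set b := fine (sup_Linfty phi); set v := fine (lebesgue_eucl R d D).
have Dfin := uniform_on_finite (unifX 0%N).
have vE : lebesgue_eucl R d D = v%:E by rewrite fineK// ge0_fin_numE// ltW.
have v0 : 0 < v by rewrite -lte_fin -vE.
have nu_fin : (lebesgue_on cD setT < +oo)%E by rewrite lebesgue_on_setT.
have b0 : 0 <= b by exact: sup_Linfty_ge0.
have [_ [ortho _] _] := eigen.
have vb0 : 0 <= v * b ^+ 2 by rewrite mulr_ge0 ?sqr_ge0// ltW.
have cE : c = 4 + 400 * (v * b ^+ 2) by rewrite /c gtr0_norm// mulrA.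
have c4 : 4 <= c by rewrite cE lerDl; exact: mulr_ge0 (ler0n _ _) vb0.
have c0 : 0 < c by rewrite (lt_le_trans _ c4).
pose f k z := Num.sqrt v * clipped_basis phi k z.
have mf k : measurable_fun setT (f k).
  by apply: measurable_funM => //; exact: measurable_clipped_basis.
have f_le k z : f k z ^+ 2 <= v * b ^+ 2.
  rewrite /f exprMn sqr_sqrtr ?(ltW v0)// ler_wpM2l ?(ltW v0)//.
  rewrite -(real_normK (num_real (clipped_basis phi k z))).
  by rewrite ler_pXn2r ?nnegrE// clipped_basis_le.
have f_ortho n k l := integral_clipped_basis D0 ortho phi_bdd k l (unifX n).
(* With the integer part, m <= l is equivalent to M / (c ln M) < l + 1, so the tail from m on is
   exactly the required sum. *)
pose m M := Num.truncn (M%:R / (c * ln (M%:R : R))).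
have large : \forall M \near \oo, [/\ (1 < M)%N, 1 <= c * ln (M%:R : R) &
    c * ln (M%:R : R) <= M%:R].
  near=> M.
  have M4 : 4 <= M%:R :> R by near: M; exact: nbhs_infty_ger.
  have M0 : 0 < M%:R :> R by rewrite (lt_le_trans _ M4).
  (* Together with c >= 4 this gives c ln M >= 1, hence m <= M. It follows from ln (1 + x) <= x at x
     = -3/4. *)
  have ln1 : 4^-1 <= ln (M%:R : R).
    have h : -1 < - (3 / 4) :> R by lra.
    have := le_ln1Dx h; have -> : 1 + - (3 / 4) = 4^-1 :> R by field.
    rewrite lnV ?posrE// lerN2; have : ln 4 <= ln (M%:R : R).
      by rewrite ler_ln ?posrE.
    by set y := ln 4; set z := ln _; lra.
  split.
  - by near: M; exact: nbhs_infty_gt.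
  - apply: (@le_trans _ _ (4 * 4^-1)); first by rewrite mulfV.
    by apply: ler_pM.
  - rewrite (@le_trans _ _ (c * (1 + ln (M%:R : R))))//.
      by rewrite ler_wpM2l ?(ltW c0)// lerDr.
    by near: M; exact: ln_near_linear.
have m_le M : 1 <= c * ln (M%:R : R) -> (m M)%:R * (c * ln (M%:R : R)) <= M%:R.
  move=> cl; rewrite -ler_pdivlMr ?(lt_le_trans ltr01)//.
  by rewrite truncn_le divr_ge0// (le_trans ler01).
have hm : \forall M \near \oo, (m M <= M)%N /\
    400 * (v * b ^+ 2) * (m M)%:R * ln (M%:R : R) <= M%:R.
  apply: filterS large => M [M1 cl clM]; have mM := m_le M cl; split.
    by rewrite -(ler_nat R) (le_trans _ mM)// ler_peMr.
  apply: le_trans mM; rewrite [leRHS]mulrCA -mulrA; apply: ler_wpM2r.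
    by apply: mulr_ge0; rewrite ?ler0n// ln_ge0// ler1n ltnW.
  by rewrite cE lerDr.
have lower := sampling_lower_bound indepX mf f_le f_ortho hm.
have evalX : {ae P, forall w, forall n, support_point cD (X n w) /\
    forall k, clipped_basis phi k (X n w) = peval (phi k) (X n w)}.
  apply: ae_foralln => n.
  exact: (ae_uniform (unifX n) (ae_clipped_eval D0 phiC phi_bdd)).
apply: filterS2 lower evalX => w lowerw evalw.
near=> M.
have [M1 cl clM] : [/\ (1 < M)%N, 1 <= c * ln (M%:R : R) &
    c * ln (M%:R : R) <= M%:R] by near: M.
have M0 : 0 < M%:R :> R by rewrite ltr0n ltnW.
have cl0 : 0 < c * ln (M%:R : R) by rewrite (lt_le_trans ltr01).
exists (m M).
pose x (j : 'I_M) := X j w.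
pose th := M%:R / (8 * v).
have th0 : 0 < th by rewrite divr_gt0// mulr_gt0.
have gramE : \sum_(j < M) (\col_(k < m M) f k (X j w)) *m (\col_k f k (X j w))^T =
    v *: gram phi (m M) x.
  apply/matrixP => k l; rewrite summxE !mxE mulr_sumr; apply: eq_bigr => j _.
  rewrite !mxE big_ord1 !mxE /f mulrACA -expr2 sqr_sqrtr ?(ltW v0)//.
  by rewrite !(evalw j).2.
have thG a : th * mxform 1%:M a a <= mxform (gram phi (m M) x) a a.
  have : M%:R / 8 * mxform 1%:M a a <=
      mxform (\sum_(j < M) (\col_(k < m M) f k (X j w)) *m (\col_k f k (X j w))^T) a a.
    by move: a; near: M.
  rewrite gramE mxformZm -ler_pdivrMl//; apply: le_trans.
  by rewrite le_eqVlt; apply/orP; left; apply/eqP; rewrite /th; field; rewrite gt_eqF.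
have [uG err] := encoding_error_le nu_fin covGamma eigen muC phiC b0
  (ae_sup_Linfty D0 phi_bdd) th0 (fun j => (evalw j).1) thG.
split=> //.
  rewrite truncn_gt0 ler_pdivlMr// mul1r clM/=.
  by rewrite -(ler_nat R) (le_trans _ (m_le M cl))// ler_peMr.
apply: le_trans err _.
have -> : (\sum_(m M <= l <oo) (lam l)%:E =
    \sum_(0 <= l <oo | (M%:R / (c * ln M%:R) < l.+1%:R)%R) (lam l)%:E)%E.
  rewrite eseries_cond; apply: eq_eseriesl => l /=.
  by rewrite -truncn_lt_nat ?ltnS// divr_ge0// ltW.
set T := (\big[_/_]_(_ <= _ <oo | _) _)%E.
have -> : c%:E = sqrte (c%:E ^+ 2) by rewrite sqrte_sqr gee0_abs// lee_fin ltW.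
have lam0 := eigenvalue_ge0 covGamma eigen.
have T0 : (0 <= T)%E by apply: nneseries_ge0 => l _ _; rewrite lee_fin.
rewrite -sqrteM ?sqre_ge0// lee_sqrt; last by rewrite mule_ge0// sqre_ge0.
rewrite lee_wpmul2r// -EFin_expe lee_fin.
(* The constant under the root becomes 16 v b^2 + 4, which is at most c and hence at most c^2. *)
have -> : 2 / th * M%:R = 16 * v by rewrite /th; field; rewrite !gt_eqF.
rewrite (@le_trans _ _ c)//.
  by rewrite cE -mulrA addrC lerD2l ler_wpM2r// ler_nat.
by rewrite expr2 ler_peMr ?(ltW c0)// (le_trans _ c4)// ler1n.
Unshelve. all: by end_near. Qed.
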